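(* Let $\beta\in(0,1]$. There exists a constant $C$ depending only on $\beta$ such that the following holds. Assume there exists $u_n\ge1$ such that $\|b_j(X_1,\dots,X_r)\|_{\psi_\beta}\le u_n$ for all $j=1,\dots,d$. Let $$Z:=\max_{1\le j\le d}\left||I_{n,r}|^{-1}\sum_{\iota\in I_{n,r}}\big(F_j(X_\iota,W_\iota)-f_j(X_\iota)\big)\right|.$$ Then with probability at least $1-9/n$, $$Z\le Cu_n|I_{n,r}|^{-1/2}r^{1/2}\log^{1/2}(dn)\left(1+n^{-1/2}r^{1/2}\log^{1/\beta+1/2}(dn)\log^{1/\beta-1/2}(n)\right)+Cu_n|I_{n,r}|^{-1}r^{3/\beta}\log^{2/\beta+1}(dn)\log^{2/\beta-1}(n).$$
   Context: $n\ge4$, $d\ge3$, $2\le r\le n$ are integers. $X_1,\dots,X_n$ are i.i.d. random variables in a measurable space $(S,\mathcal{S})$; $I_{n,r}=\{\iota=(i_1,\dots,i_r):1\le i_1<\dots<i_r\le n\}$; $X_\iota=(X_{i_1},\dots,X_{i_r})$; $W,\{W_\iota:\iota\in I_{n,r}\}$ are i.i.d. random variables in a measurable space $(S',\mathcal{S}')$, independent of $X_1,\dots,X_n$. $F:S^r\times S'\to\mathbb{R}^d$ is measurable and symmetric in the first $r$ variables. Define $f(x_1,\dots,x_r):=\mathbb{E}[F(x_1,\dots,x_r,W)]$ and $b_j(x_1,\dots,x_r):=\|F_j(x_1,\dots,x_r,W)-f_j(x_1,\dots,x_r)\|_{\psi_\beta}$ for $j=1,\dots,d$. For a real random variable $\xi$,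 $\|\xi\|_{\psi_\beta}=\inf\{C>0:\mathbb{E}[e^{(|\xi|/C)^\beta}-1]\le1\}$. $\log^a(x)=(\log x)^a$. *)

(* Defs.v *)
From HB Require Import structures.
From mathcomp Require Import all_boot all_order all_algebra perm.
From mathcomp Require Import all_classical all_reals all_analysis.

Set Implicit Arguments.
Unset Strict Implicit.
Unset Printing Implicit Defensive.

Import Order.TTheory GRing.Theory Num.Theory.
Import numFieldNormedType.Exports.

Local Open Scope classical_set_scope.
Local Open Scope ring_scope.

(* I_{n,r}; indices run over 0, ..., n-1. *)
Notation incr_index n r :=
  {iota : r.-tuple 'I_n | sorted ltn [seq val i | i <- iota]}.

Section RandomVariables.
Context {dO : measure_display} {Omega : measurableType dO} {R : realType}.
Variable P : probability Omega R.

(* Equality of laws is only required on measurable sets: a measure takes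
   unspecified values on the other sets. *)
Definition same_law {dT} {T : measurableType dT} (X Y : {RV P >-> T}) :=
  forall A, measurable A -> distribution P X A = distribution P Y A.

Definition mutually_independent {dT} {T : measurableType dT} {K : finType}
    (X : K -> {RV P >-> T}) :=
  forall (J : {set K}) (A : K -> set T),
    (forall k, k \in J -> measurable (A k)) ->
    P (\bigcap_(k in [set` J]) (X k @^-1` A k)) =
    (\prod_(k in J) P (X k @^-1` A k))%E.

Definition iid {dT} {T : measurableType dT} {K : finType}
    (X : K -> {RV P >-> T}) :=
  mutually_independent X /\ (forall k l, same_law (X k) (X l)).

Definition sigma_family {dT} {T : measurableType dT} {K : finType}
    (X : K -> {RV P >-> T}) : set (set Omega) :=
  <<s \bigcup_k g_sigma_algebra_preimage (X k) >>.

Definition independent_families {dT} {T : measurableType dT} {K : finType}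
    {dT'} {T' : measurableType dT'} {L : finType}
    (X : K -> {RV P >-> T}) (Y : L -> {RV P >-> T'}) :=
  forall A B, sigma_family X A -> sigma_family Y B ->
    P (A `&` B) = (P A * P B)%E.

(* Both the argument and the value are extended reals: the norm is +oo when no
   C is admissible, and the functions b_j below may take the value +oo. *)
Definition psi_norm (beta : R) (xi : Omega -> \bar R) : \bar R :=
  ereal_inf [set C%:E | C in
    [set C : R | 0 < C /\
      (\int[P]_w (expeR ((`|xi w| * (C^-1)%:E) `^ beta) - 1) <= 1)%E]].

Section Kernel.
Context {dS : measure_display} {S : measurableType dS}.
Context {dS' : measure_display} {S' : measurableType dS'}.
Variables (n d r : nat) (F : r.-tuple S * S' -> d.-tuple R).

Definition symmetric_kernel :=
  forall (s : 'S_r) (x : r.-tuple S) (w : S'),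
    F ([tuple tnth x (s k) | k < r], w) = F (x, w).

(* Where F_j(x, W) is not integrable this is an arbitrary real number, but then
   kernel_b is +oo at x. *)
Definition kernel_f (W : {RV P >-> S'}) (j : 'I_d) (x : r.-tuple S) : R :=
  fine 'E_P[fun w => tnth (F (x, W w)) j].

Definition kernel_b (beta : R) (W : {RV P >-> S'}) (j : 'I_d)
    (x : r.-tuple S) : \bar R :=
  psi_norm beta (fun w => (tnth (F (x, W w)) j - kernel_f W j x)%:E).

Definition X_at (X : 'I_n -> {RV P >-> S}) (iota : r.-tuple 'I_n)
    (w : Omega) : r.-tuple S :=
  [tuple X (tnth iota k) w | k < r].

Definition Zmax (X : 'I_n -> {RV P >-> S}) (W : {RV P >-> S'})
    (Wi : incr_index n r -> {RV P >-> S'}) (w : Omega) : R :=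
  \big[Num.max/0]_(j < d)
    `| #|{: incr_index n r}|%:R^-1 *
       \sum_(iota : incr_index n r)
          (tnth (F (X_at X (val iota) w, Wi iota w)) j
           - kernel_f W j (X_at X (val iota) w)) |.

End Kernel.
End RandomVariables.

Definition Zbound {R : realType} (beta C u : R) (n d r : nat) : R :=
  let N : R := #|{: incr_index n r}|%:R in
  let Ldn : R := ln (d * n)%:R in
  let Ln : R := ln n%:R in
  C * u * N `^ (- 2^-1) * r%:R `^ 2^-1 * Ldn `^ 2^-1 *
    (1 + n%:R `^ (- 2^-1) * r%:R `^ 2^-1 * Ldn `^ (beta^-1 + 2^-1)
         * Ln `^ (beta^-1 - 2^-1))
  + C * u * N^-1 * r%:R `^ (3 / beta) * Ldn `^ (2 / beta + 1)
         * Ln `^ (2 / beta - 1).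

(* Main.v *)
Require Import Defs.
From HB Require Import structures.
From mathcomp Require Import all_boot all_order all_algebra.
From mathcomp Require Import perm fingroup action primitive_action alt.
From mathcomp Require Import all_classical all_reals all_analysis.
From mathcomp Require Import measurable_realfun ring lra.

Set Implicit Arguments.
Unset Strict Implicit.
Unset Printing Implicit Defensive.

Import Order.TTheory GRing.Theory Num.Theory.
Import numFieldNormedType.Exports.

Local Open Scope classical_set_scope.
Local Open Scope ring_scope.

(** Fix a coordinate j, put y = F_j - f_j and let b(x) be the psi_beta norm of
    y(x, W); write L = log(dn) and N = |I_{n,r}|. Given the sample X_1, ...,
    X_n the variables y(X_iota, W_iota) are independent and centered, with
    norms b(X_iota). A Bernstein bound given the sample therefore controls
    their sum by the square root of L times the sum of the b(X_iota)^2, plus L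
    times the truncation level. So two facts about the norms are needed: none
    of them is large, and the average of their squares is not much larger than
    u^2.

    The norms b(X_iota) have psi_beta norm at most u, so a union bound over the
    N <= n^r indices keeps them all below a multiple of u (r L)^(1/beta)
    ([max_norm_tail]). The average of the squares is a U-statistic. Hoeffding's
    device writes it as an average over permutations of means of m = floor(n/r)
    independent terms, one for each block of r consecutive indices; by
    convexity its exponential moments are bounded by those of one such mean
    ([ustat_expectation]). Applied to the squares of b / (2u), truncated at T =
    (2L)^(1/beta), it bounds their average by a constant plus a multiple of T^2
    L / m ([low_part_tail]). The remaining part has expectation of order
    exp(-L), and Markov's inequality disposes of it ([high_part_tail]).

    Given the sample, each y(X_iota, W_iota) is compared with its own norm,
    shifted by u to be positive: with c = b(X_iota) + u and tau = (3 r
    L)^(1/beta), a union bound shows that no |y| exceeds tau c ([mark_tail]).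
    On that event the moment generating function of y is integrated only over
    {y <= tau c}, where exp(z) <= 1 + z + 2 z^2; the right-hand side may be
    integrated over the whole space, the linear term vanishes because y is
    centered, and no bias due to the truncation appears
    ([weighted_exp_integral], [sum_tail]).

    For each j six events are excluded, each of probability at most exp(-L) =
    1/(dn) ([marked_sum_deviation]); over all j this gives failure probability
    6/n. The price of truncating at tau is a term of order u tau^2 L / N, which
    the second term of the bound covers; the term T^2 L / m, at most 2 T^2 L r
    / n, enters under a square root and is covered by the parenthesis of the
    first term ([deviation_le_Zbound]).

    The probabilistic facts behind the two conditioning steps are that disjoint
    groups of independent variables are independent ([coord_events_indep]) and
    that, the sample being independent of the marks W_iota, expectations of
    products may be computed mark by mark with the sample frozen
    ([conditional_product]). *)

(** * Independence of disjoint groups of coordinates *)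

Section Independence.
Local Open Scope ereal_scope.
Context {dO : measure_display} {Omega : measurableType dO} {R : realType}.
Variable P : probability Omega R.
Context {dT : measure_display} {T : measurableType dT} {K : finType}.
Variable X : K -> {RV P >-> T}.

(** A generating family of the sigma-algebra of (X_k), k in J; for the full set
    of indices it generates [sigma_family X]. *)
Definition coord_events (J : {set K}) : set (set Omega) :=
  \bigcup_(k in [set` J]) g_sigma_algebra_preimage (X k).

(** A pi-system generating the same sigma-algebra as [coord_events J]; on it
    independence is the product rule. *)
Definition coord_rects (J : {set K}) : set (set Omega) :=
  [set B | exists2 A : K -> set T, (forall k, measurable (A k)) &
     B = \bigcap_(k in [set` J]) X k @^-1` A k].

Lemma coord_rects_measurable J : coord_rects J `<=` measurable.
Proof.
move=> _ [A mA ->]; apply: fin_bigcap_measurable => [|k _].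
  exact: finite_finset.
by rewrite -[_ @^-1` _]setTI; exact: measurable_funP.
Qed.

Lemma coord_events_measurable J : <<s coord_events J >> `<=` measurable.
Proof.
apply: smallest_sub; first exact: sigma_algebra_measurable.
by move=> _ [k _ [B mB <-]]; exact: measurable_funP.
Qed.

Lemma coord_eventsS (J J' : {set K}) : J \subset J' ->
  <<s coord_events J >> `<=` <<s coord_events J' >>.
Proof.
move=> /fintype.subsetP JJ'; apply: sub_sigma_algebra2 => A [k /= kJ kA].
exists k => //=.
exact: JJ'.
Qed.

Lemma coord_rects_setI J : setI_closed (coord_rects J).
Proof.
move=> _ _ [A mA ->] [B mB ->]; exists (fun k => A k `&` B k).
  by move=> k; exact: measurableI.
by rewrite -bigcapI; apply: eq_bigcapr => k _; rewrite preimage_setI.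
Qed.

Lemma coord_rectsT J : coord_rects J setT.
Proof.
by exists (fun=> setT) => //; apply/seteqP; split.
Qed.

Lemma coord_events_rects J : <<s coord_events J >> `<=` <<s coord_rects J >>.
Proof.
apply: sub_sigma_algebra2 => _ [k /= kJ [B mB <-]].
exists (fun l => if l == k then B else setT) => [l|]; first by case: ifP.
rewrite setTI; apply/seteqP; split => w /=.
  by move=> Bw l _ /=; case: eqP => [->|].
by move=> /(_ k kJ); rewrite /= eqxx.
Qed.

Hypothesis Xindep : mutually_independent X.
Variables J1 J2 : {set K}.
Hypothesis J12 : forall k, k \in J1 -> k \notin J2.

Lemma coord_rects_indep A B : coord_rects J1 A -> coord_rects J2 B ->
  P (A `&` B) = P A * P B.
Proof.
move=> [A1 mA1 ->] [A2 mA2 ->].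
pose A' k := if k \in J1 then A1 k else A2 k.
have mA' k : measurable (A' k) by rewrite /A'; case: ifP.
have E1 : \bigcap_(k in [set` J1]) X k @^-1` A1 k =
          \bigcap_(k in [set` J1]) X k @^-1` A' k.
  by apply: eq_bigcapr => k /= kJ; rewrite /A' kJ.
have E2 : \bigcap_(k in [set` J2]) X k @^-1` A2 k =
          \bigcap_(k in [set` J2]) X k @^-1` A' k.
  apply: eq_bigcapr => k /= kJ; rewrite /A' ifN//.
  by apply: contraL kJ; exact: J12.
have E12 : \bigcap_(k in [set` J1]) X k @^-1` A' k `&`
  \bigcap_(k in [set` J2]) X k @^-1` A' k =
  \bigcap_(k in [set` J1 :|: J2]) X k @^-1` A' k.
  rewrite -bigcap_setU; congr bigcap; apply/seteqP; split => k /=.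
    by move=> [?|?]; rewrite inE; apply/orP; [left|right].
  by rewrite inE => /orP.
rewrite E1 E2 E12 !Xindep//.
rewrite (bigID (mem J1))/=; congr (_ * _); apply: eq_bigl => k; rewrite !inE.
  by case: (k \in J1); rewrite ?andbF.
have := J12 (k := k); case: (k \in J1) => [/(_ isT)/negbTE->|_].
  by rewrite ?andbF.
by rewrite ?andbT.
Qed.

(** Two measures that agree on a pi-system agree on the sigma-algebra it
    generates. Applied with the second event fixed, this extends the product
    rule from rectangles one argument at a time. *)
Lemma coord_events_indep A B :
  <<s coord_events J1 >> A -> <<s coord_events J2 >> B ->
  P (A `&` B) = P A * P B.
Proof.
have step (C : set Omega) (J : {set K}) : measurable C ->
    (forall D, coord_rects J D -> P (D `&` C) = P D * P C) ->
    forall D, <<s coord_events J >> D -> P (D `&` C) = P D * P C.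
  move=> mC rectC D /coord_events_rects sD.
  have c0 : (0 <= fine (P C))%R by exact/fine_ge0.
  have PC : (fine (P C))%:E = P C by rewrite fineK// fin_num_measure.
  pose m1 := mrestr P mC; pose m2 := mscale (NngNum c0) P.
  suff : m1 D = m2 D by rewrite /m1 /m2 /mrestr/= /mscale/= PC muleC.
  apply: (@g_sigma_algebra_measure_unique _ R _ _ (@coord_rects_measurable J)
    (fun=> setT) (fun=> @coord_rectsT J) _ m1 m2 (@coord_rects_setI J)) => //.
  - by apply/seteqP; split => // w _; exists 0%N.
  - by move=> E /rectC; rewrite /m1 /m2 /mrestr/= /mscale/= PC muleC.
  - move=> _; apply: (@le_lt_trans _ _ 1); last by rewrite ltry.
    by apply: probability_le1; exact: measurableI.
move=> sA sB.
have mA := coord_events_measurable sA.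
have mB := coord_events_measurable sB.
apply: (step B J1) sA => // D rD.
rewrite setIC muleC; apply: (step D J2) sB => //.
  exact: coord_rects_measurable rD.
by move=> E rE; rewrite setIC coord_rects_indep// muleC.
Qed.

End Independence.

Section IndependentExpectation.
Local Open Scope ereal_scope.
Context {dO : measure_display} {Omega : measurableType dO} {R : realType}.
Variable P : probability Omega R.

(** The law of (U, V) is the product of the two laws, because it agrees with
    the product on rectangles; the identity is then Tonelli's theorem, written
    on the original probability space. *)
Lemma indep_fubini {d1} {E1 : measurableType d1} {d2} {E2 : measurableType d2}
    (U : {RV P >-> E1}) (V : {RV P >-> E2}) (G : E1 * E2 -> \bar R) :
  (forall A B, measurable A -> measurable B ->
     P (U @^-1` A `&` V @^-1` B) = P (U @^-1` A) * P (V @^-1` B)) ->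
  measurable_fun [set: E1 * E2] G -> (forall z, 0 <= G z) ->
  \int[P]_w G (U w, V w) = \int[P]_w \int[P]_v G (U w, V v).
Proof.
move=> UV mG G0.
have mUV : measurable_fun setT (fun w => (U w, V w)).
  by apply/measurable_fun_pair => //; exact: measurable_funP.
pose UVm : {mfun Omega >-> (E1 * E2)%type} := HB.pack (fun w => (U w, V w))
  (isMeasurableFun.Build _ _ _ _ _ mUV).
pose W : {RV P >-> (E1 * E2)%type} := UVm.
have -> : \int[P]_w G (U w, V w) = \int[distribution P W]_z G z.
  by rewrite ge0_integral_distribution.
rewrite (eq_measure_integral (distribution P U \x distribution P V)); last first.
  by move=> A mA _; apply/esym; apply: product_measure_unique => // B C mB mC;
    exact: UV.
rewrite fubini_tonelli1// /fubini_F.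
rewrite ge0_integral_distribution//; last 2 first.
  exact: measurable_fun_fubini_tonelli_F.
  by move=> x; apply: integral_ge0.
apply: eq_integral => w _ /=; rewrite ge0_integral_distribution//.
exact: measurableT_comp.
Qed.

Context {dT : measure_display} {T : measurableType dT} {K : finType}.
Variable X : K -> {RV P >-> T}.

(** Omega with the sigma-algebra of (X_k), k in J. Measurability with respect
    to these variables becomes measurability on a measurable type, so the
    closure properties of measurable functions apply to it. *)
Definition coord_space (J : {set K}) : Type :=
  g_sigma_algebraType (coord_events X J).
HB.instance Definition _ J := Measurable.on (coord_space J).

Lemma measurable_coord (J : {set K}) k : k \in J ->
  measurable_fun [set: coord_space J] (X k : coord_space J -> T).
Proof.
move=> kJ _ B mB; rewrite setTI; apply: sub_sigma_algebra; exists k => //.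
by exists B => //; rewrite setTI.
Qed.

Lemma measurable_coord_spaceS {d'} {T' : measurableType d'} (J J' : {set K})
    (f : Omega -> T') : J \subset J' ->
  measurable_fun [set: coord_space J] (f : coord_space J -> T') ->
  measurable_fun [set: coord_space J'] (f : coord_space J' -> T').
Proof.
move=> JJ' mf _ B mB; have := mf measurableT B mB; rewrite !setTI.
exact: coord_eventsS.
Qed.

Lemma measurable_coord_space {d'} {T' : measurableType d'} (J : {set K})
    (f : Omega -> T') :
  measurable_fun [set: coord_space J] (f : coord_space J -> T') ->
  measurable_fun [set: Omega] f.
Proof.
move=> mf _ B mB; have := mf measurableT B mB; rewrite !setTI.
exact: coord_events_measurable.
Qed.

Hypothesis Xindep : mutually_independent X.

Lemma indep_expectation_mul (J1 J2 : {set K}) (U V : Omega -> \bar R) :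
  (forall k, k \in J1 -> k \notin J2) ->
  measurable_fun [set: coord_space J1] (U : coord_space J1 -> \bar R) ->
  measurable_fun [set: coord_space J2] (V : coord_space J2 -> \bar R) ->
  (forall w, 0 <= U w) -> (forall w, 0 <= V w) ->
  \int[P]_w (U w * V w) = \int[P]_w U w * \int[P]_w V w.
Proof.
move=> J12 mU mV U0 V0.
have mU' := measurable_coord_space mU; have mV' := measurable_coord_space mV.
pose Um : {mfun Omega >-> \bar R} := HB.pack U
  (isMeasurableFun.Build _ _ _ _ _ mU').
pose Vm : {mfun Omega >-> \bar R} := HB.pack V
  (isMeasurableFun.Build _ _ _ _ _ mV').
have UV (A B : set (\bar R)) : measurable A -> measurable B ->
    P ((Um : {RV P >-> \bar R}) @^-1` A `&` (Vm : {RV P >-> \bar R}) @^-1` B) =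
    P ((Um : {RV P >-> \bar R}) @^-1` A) * P ((Vm : {RV P >-> \bar R}) @^-1` B).
  move=> mA mB; apply: (coord_events_indep Xindep J12).
    by have := mU measurableT A mA; rewrite setTI.
  by have := mV measurableT B mB; rewrite setTI.
(* Absolute values make the integrand nonnegative on the whole plane. *)
pose G (z : \bar R * \bar R) := `|z.1| * `|z.2|.
have mG : measurable_fun [set: \bar R * \bar R] G.
  by apply: emeasurable_funM; apply: measurableT_comp.
have := indep_fubini UV mG (fun z => mule_ge0 (abse_ge0 _) (abse_ge0 _)).
rewrite /G/= /Um /Vm/=.
under eq_integral do rewrite !gee0_abs//.
move=> ->.
under eq_integral.
  move=> w _; under eq_integral do rewrite !gee0_abs//.
  rewrite ge0_integralZl//; over.
by rewrite ge0_integralZr//; exact: integral_ge0.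
Qed.

(** Induction on [s]: the product over the tail is measurable for the union of
    the remaining groups, which is disjoint from the first one. *)
Lemma indep_expectation_prod (I : eqType) (s : seq I) (B : I -> {set K})
    (U : I -> Omega -> \bar R) :
  uniq s ->
  (forall i j, i \in s -> j \in s -> i != j ->
     forall k, k \in B i -> k \notin B j) ->
  (forall i,
     measurable_fun [set: coord_space (B i)] (U i : coord_space (B i) -> _)) ->
  (forall i w, 0 <= U i w) ->
  \int[P]_w (\prod_(i <- s) U i w) = \prod_(i <- s) \int[P]_w U i w.
Proof.
move=> + + mU U0; elim: s => [_ _|i s IH /= /andP[is_ us] disj].
  rewrite big_nil; under eq_integral do rewrite big_nil.
  by rewrite integral_cst// mul1e; exact: probability_setT.
rewrite big_cons -IH//; last first.
  by move=> a b as_ bs; apply: disj; rewrite inE ?as_ ?bs orbT.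
under eq_integral do rewrite big_cons.
pose J := finset (fun k => has (fun j => k \in B j) s).
rewrite (@indep_expectation_mul (B i) J)//.
- move=> k ki; rewrite inE; apply/hasPn => j js.
  apply: (disj i j) => //; rewrite ?inE ?eqxx ?js ?orbT//.
  by apply: contraNneq is_ => ->.
- rewrite (_ : (fun w => _) =
      fun w => \prod_(j <- s | j \in s) U j w); last first.
    by apply/funext => w; rewrite big_seq.
  (* The guard j \in s lets the induction run over a suffix of s while J is
     fixed. *)
  have : {subset s <= s} by [].
  elim: {1 3}s => [_|j t IHt ts].
    rewrite (_ : (fun=> _) = cst 1); first exact: measurable_cst.
    by apply/funext => w; rewrite big_nil.
  rewrite (_ : (fun=> _) = fun w => U j w * \prod_(j <- t | j \in s) U j w).
    apply: emeasurable_funM; last first.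
      by apply: IHt => k kt; apply: ts; rewrite inE kt orbT.
    apply: measurable_coord_spaceS (mU j).
    apply/fintype.subsetP => k kj; rewrite inE; apply/hasP; exists j => //.
    by apply: ts; rewrite inE eqxx.
  by apply/funext => w; rewrite big_cons ts// inE eqxx.
- by move=> w; apply: prode_ge0.
Qed.

End IndependentExpectation.

(** * Laws of subsamples *)

Section TupleLaw.
Local Open Scope ereal_scope.
Context {dO : measure_display} {Omega : measurableType dO} {R : realType}.
Variable P : probability Omega R.
Context {dT : measure_display} {T : measurableType dT}.

(** Rectangles form a pi-system generating the sigma-algebra of tuples. *)
Lemma tuple_law_unique (r : nat) (f g : {RV P >-> r.-tuple T}) :
  (forall A : 'I_r -> set T, (forall i, measurable (A i)) ->
    P (\bigcap_i [set w | A i (tnth (f w) i)]) =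
    P (\bigcap_i [set w | A i (tnth (g w) i)])) ->
  same_law f g.
Proof.
move=> fg.
pose G : set (set (r.-tuple T)) :=
  [set B | exists2 A : 'I_r -> set T, (forall i, measurable (A i)) &
     B = \bigcap_i [set x | A i (tnth x i)]].
have GT : G setT by exists (fun=> setT) => //; apply/seteqP; split.
have Gm : G `<=` measurable.
  move=> _ [A mA ->]; apply: fin_bigcap_measurable => [|i _].
    exact: finite_finset.
  rewrite -[X in measurable X]setTI; exact: measurable_tnth.
have GI : setI_closed G.
  move=> _ _ [A mA ->] [B mB ->]; exists (fun k => A k `&` B k).
    by move=> k; exact: measurableI.
  by rewrite -bigcapI.
move=> B mB; apply: (@g_sigma_algebra_measure_unique _ R _ _ Gm
   (fun=> setT) (fun=> GT) _ (distribution P f) (distribution P g) GI) => //.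
- by apply/seteqP; split => // w _; exists 0%N.
- by move=> _ [A mA ->]; have := fg A mA; rewrite /distribution /pushforward/=.
- by move=> _; apply: le_lt_trans (probability_le1 _ measurableT) (ltry _).
- move: mB; apply: sub_sigma_algebra2 => C.
  rewrite -bigcup_seq => -[i _ [D mD <-]].
  exists (fun k => if k == i then D else setT); first by move=> k; case: ifP.
  rewrite setTI; apply/seteqP; split => x /=.
    by move=> Dx k _ /=; case: eqP => // ->.
  by move=> /(_ i I); rewrite /= eqxx.
Qed.

Variable n : nat.
Variable X : 'I_n -> {RV P >-> T}.

Lemma measurable_X_at r (iota : r.-tuple 'I_n) :
  measurable_fun [set: Omega] (X_at X iota).
Proof.
apply/measurable_fun_tnthP => i.
rewrite (_ : _ \o _ = X (tnth iota i)) ; first exact: measurable_funP.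
by apply/funext => w; rewrite /= tnth_mktuple.
Qed.

Lemma measurable_coord_X_at r (iota : r.-tuple 'I_n) (J : {set 'I_n}) :
  {subset iota <= J} ->
  measurable_fun [set: coord_space X J]
    (X_at X iota : coord_space X J -> r.-tuple T).
Proof.
move=> iJ; apply/measurable_fun_tnthP => i.
rewrite (_ : _ \o _ = X (tnth iota i)).
  by apply: measurable_coord; apply: iJ; exact: mem_tnth.
by apply/funext => w; rewrite /= tnth_mktuple.
Qed.

HB.instance Definition _ r (iota : r.-tuple 'I_n) :=
  isMeasurableFun.Build _ _ _ _ (X_at X iota) (measurable_X_at iota).

Hypothesis Xiid : iid X.

Lemma X_at_rect r (iota : r.-tuple 'I_n) (A : 'I_r -> set T) :
  uniq iota -> (forall i, measurable (A i)) ->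
  P (\bigcap_i [set w | A i (tnth (X_at X iota w) i)]) =
  \prod_(i < r) P (X (tnth iota i) @^-1` A i).
Proof.
move=> /tuple_uniqP inj_i mA.
pose J := imset (tnth iota) (mem 'I_r).
(* The sets A transported to the indices in the range of iota. *)
pose A' k := if [pick i | tnth iota i == k] is Some i then A i else setT.
have A'i i : A' (tnth iota i) = A i.
  rewrite /A'; case: pickP => [j /eqP/inj_i -> //|/(_ i)].
  by rewrite eqxx.
have mA' k : measurable (A' k) by rewrite /A'; case: pickP.
transitivity (P (\bigcap_(k in [set` J]) X k @^-1` A' k)).
  congr (P _); apply/seteqP; split => w /=.
    move=> Aw _ /imsetP[i _ ->] /=; rewrite A'i.
    by have := Aw i I; rewrite /= tnth_mktuple.
  move=> Aw i _ /=; rewrite tnth_mktuple -A'i; apply: Aw => /=.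
  exact: imset_f.
rewrite (Xiid.1 J A')// big_imset/=; last by move=> i j _ _ /inj_i.
by apply: eq_bigr => i _; rewrite A'i.
Qed.

Lemma X_at_same_law r (iota kappa : r.-tuple 'I_n) :
  uniq iota -> uniq kappa ->
  same_law (X_at X iota : {RV P >-> r.-tuple T})
           (X_at X kappa : {RV P >-> r.-tuple T}).
Proof.
move=> ui uk; apply: tuple_law_unique => A mA; rewrite !X_at_rect//.
by apply: eq_bigr => i _; exact: Xiid.2.
Qed.

End TupleLaw.

Section SameLawIntegral.
Local Open Scope ereal_scope.
Context {dO : measure_display} {Omega : measurableType dO} {R : realType}.
Variable P : probability Omega R.
Context {dT : measure_display} {T : measurableType dT}.

Lemma same_law_integral (f g : {RV P >-> T}) (h : T -> \bar R) :
  same_law f g -> measurable_fun setT h -> (forall x, 0 <= h x) ->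
  \int[P]_w h (f w) = \int[P]_w h (g w).
Proof.
move=> fg mh h0.
transitivity (\int[distribution P f]_x h x).
  by rewrite ge0_integral_distribution.
transitivity (\int[distribution P g]_x h x).
  by apply: eq_measure_integral => A mA _; exact: fg.
by rewrite ge0_integral_distribution.
Qed.

End SameLawIntegral.

(** * Conditioning on the sample *)

Lemma emeasurable_fun_bigprod {R : realType} {d} {T : measurableType d}
    (I : Type) (s : seq I) (f : I -> T -> \bar R) :
  (forall i, measurable_fun [set: T] (f i)) ->
  measurable_fun [set: T] (fun x => \prod_(i <- s) f i x)%E.
Proof.
move=> mf; elim: s => [|i s IHs].
  rewrite (_ : (fun=> _) = cst 1%E); first exact: measurable_cst.
  by apply/funext => w; rewrite big_nil.
rewrite (_ : (fun=> _) = fun x => (f i x * \prod_(j <- s) f j x)%E).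
  exact: emeasurable_funM.
by apply/funext => w; rewrite big_cons.
Qed.

Section ConditionalProduct.
Local Open Scope ereal_scope.
Context {dO : measure_display} {Omega : measurableType dO} {R : realType}.
Variable P : probability Omega R.
Context {dS : measure_display} {S : measurableType dS}.
Context {dS' : measure_display} {S' : measurableType dS'}.
Variables (n : nat) (X : 'I_n -> {RV P >-> S}).
Variables (K : finType) (V : K -> {RV P >-> S'}).
Hypothesis XV : independent_families X V.
Hypothesis Viid : iid V.

Definition sample (w : Omega) : n.-tuple S := X_at X (ord_tuple n) w.

(** All the variables V_k gathered in one tuple, so that independence from the
    sample is a statement about two random variables. *)
Definition marks (w : Omega) : #|K|.-tuple S' :=
  [tuple V (enum_val k) w | k < #|K|].

Lemma measurable_sample : measurable_fun [set: Omega] sample.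
Proof. exact: measurable_X_at. Qed.

Lemma measurable_marks : measurable_fun [set: Omega] marks.
Proof.
apply/measurable_fun_tnthP => i.
rewrite (_ : _ \o _ = V (enum_val i)) ; first exact: measurable_funP.
by apply/funext => w; rewrite /= tnth_mktuple.
Qed.

HB.instance Definition _ :=
  isMeasurableFun.Build _ _ _ _ sample measurable_sample.
HB.instance Definition _ :=
  isMeasurableFun.Build _ _ _ _ marks measurable_marks.

Lemma sample_marks_indep A B : measurable A -> measurable B ->
  P (sample @^-1` A `&` marks @^-1` B) =
  P (sample @^-1` A) * P (marks @^-1` B).
Proof.
move=> mA mB; apply: XV.
  have H : measurable_fun [set: coord_space X finset.setT]
      (sample : coord_space X finset.setT -> n.-tuple S).
    by apply: measurable_coord_X_at => k; rewrite inE.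
  have := H measurableT A mA; rewrite setTI; apply: sub_sigma_algebra2.
  by move=> C [k _ kC]; exists k.
have H : measurable_fun [set: coord_space V finset.setT]
    (marks : coord_space V finset.setT -> #|K|.-tuple S').
  apply/measurable_fun_tnthP => i.
  rewrite (_ : _ \o _ = V (enum_val i)).
    by apply: measurable_coord; rewrite inE.
  by apply/funext => w; rewrite /= tnth_mktuple.
have := H measurableT B mB; rewrite setTI; apply: sub_sigma_algebra2.
by move=> C [k _ kC]; exists k.
Qed.

(** Tonelli's theorem freezes the sample; for a frozen sample the factors are
    functions of distinct, hence independent, marks. *)
Lemma conditional_product (I : finType) (e : I -> K)
    (h : n.-tuple S -> \bar R) (g : I -> n.-tuple S * S' -> \bar R) :
  injective e ->
  measurable_fun [set: n.-tuple S] h -> (forall x, 0 <= h x) ->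
  (forall i, measurable_fun [set: n.-tuple S * S'] (g i)) ->
  (forall i z, 0 <= g i z) ->
  \int[P]_w (h (sample w) * \prod_(i : I) g i (sample w, V (e i) w)) =
  \int[P]_w (h (sample w) * \prod_(i : I) \int[P]_v g i (sample w, V (e i) v)).
Proof.
move=> e_inj mh h0 mg g0.
pose G (z : n.-tuple S * #|K|.-tuple S') :=
  h z.1 * \prod_(i : I) g i (z.1, tnth z.2 (enum_rank (e i))).
have mG : measurable_fun [set: n.-tuple S * #|K|.-tuple S'] G.
  apply: emeasurable_funM; first exact: measurableT_comp.
  apply: emeasurable_fun_bigprod => i.
  apply: (measurableT_comp (mg i)); apply/measurable_fun_pair => //.
  by apply: (measurableT_comp (measurable_tnth _)).
have GE w v : G (sample w, marks v) =
    h (sample w) * \prod_(i : I) g i (sample w, V (e i) v).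
  rewrite /G /=; congr (_ * _); apply: eq_bigr => i _.
  by rewrite tnth_mktuple enum_rankK.
transitivity (\int[P]_w G (sample w, marks w)).
  by apply: eq_integral => w _; rewrite GE.
rewrite (indep_fubini (U := sample : {RV P >-> n.-tuple S})
  (V := marks : {RV P >-> #|K|.-tuple S'}) sample_marks_indep mG); last first.
  by move=> z; rewrite mule_ge0// prode_ge0.
apply: eq_integral => w _.
under eq_integral do rewrite GE.
have mgw i : measurable_fun [set: S'] (fun y => g i (sample w, y)).
  exact: measurableT_comp.
rewrite ge0_integralZl//; last 2 first.
  apply: emeasurable_fun_bigprod => i.
  exact: (measurableT_comp (mgw i) (measurable_funP (V (e i)))).
  by move=> v _; rewrite prode_ge0.
congr (_ * _); apply: (@indep_expectation_prod _ _ _ _ _ _ _ V Viid.1 _ _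
  (fun i => finset.set1 (e i)) (fun i v => g i (sample w, V (e i) v))) => //.
- exact: index_enum_uniq.
- move=> i j _ _ ij k /set1P ->; rewrite inE; apply: contra ij => /eqP/e_inj ->.
  by [].
- move=> i; have := @measurable_coord _ _ _ P _ _ _ V _ _ (finset.set11 (e i)).
  exact: (measurableT_comp (mgw i)).
Qed.

End ConditionalProduct.

(** * Exponential inequalities and Orlicz norms *)

Section ExpInequalities.
Context {R : realType}.

Lemma expR_le_inv1B (z : R) : z < 1 -> expR z <= (1 - z)^-1.
Proof.
move=> z1; rewrite -[z in expR z]opprK expRN.
rewrite lef_pV2 ?posrE ?expR_gt0 ?subr_gt0//.
exact: expR_ge1Dx.
Qed.

(** There is no lower bound on z: truncating a variable from above is enough to
    bound its exponential moment. *)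
Lemma expR_le_quadratic (z : R) : z <= 2^-1 -> expR z <= 1 + z + 2 * z ^+ 2.
Proof.
move=> z2; have z1 : z < 1 by lra.
apply: le_trans (expR_le_inv1B z1) _.
rewrite -div1r ler_pdivrMr ?subr_gt0//.
have : 0 <= z ^+ 2 * (1 - 2 * z) by rewrite mulr_ge0 ?sqr_ge0//; lra.
rewrite !expr2; lra.
Qed.

Lemma expR_le_linear (z : R) : 0 <= z <= 2^-1 -> expR z <= 1 + 2 * z.
Proof.
move=> /andP[z0 z2]; apply: le_trans (expR_le_quadratic z2) _.
rewrite expr2; nra.
Qed.

(** With y = a^beta / 2 and an integer k >= 2/beta, a^2 is at most 1 or at most
    (2 y)^k, and y^k / k! is a term of the exponential series. The exponent is
    halved so that the other half is left to pay for a tail. *)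
Lemma sqr_le_expR_powR (beta : R) : 0 < beta ->
  exists2 K : R, 1 <= K &
    forall a, 0 <= a -> a ^+ 2 <= K * expR (a `^ beta / 2).
Proof.
move=> b0; pose k := (Num.truncn (2 / beta)).+1.
have kb : 2 / beta <= k%:R by rewrite ltW// truncnS_gt.
exists (1 + 2 ^+ k * k`!%:R).
  by rewrite lerDl mulr_ge0.
move=> a a0; pose y := a `^ beta / 2.
have y0 : 0 <= y by rewrite divr_ge0// powR_ge0.
have ey1 : 1 <= expR y by rewrite -expR0 ler_expR.
have [a1|a1] := leP a 1.
  rewrite -/y (@le_trans _ _ 1)//; first by rewrite expr_le1.
  by rewrite mulrDl mul1r (le_trans ey1)// lerDl mulr_ge0 ?expR_ge0 ?mulr_ge0.
rewrite -/y.
have yk : y ^+ k / k`!%:R <= expR y.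
  apply: le_trans (expR_ge1Dxn (Num.truncn (2 / beta)) y0).
  by rewrite -/k lerDr.
apply: (@le_trans _ _ (2 ^+ k * y ^+ k)); last first.
  rewrite mulrDl mul1r -mulrA ler_wpDl ?expR_ge0// ler_wpM2l//.
  by rewrite mulrC -ler_pdivrMr// ltr0n fact_gt0.
rewrite -exprMn /y mulrC divfK// -(powR_mulrn k) ?powR_ge0//.
rewrite -powRrM -powR_mulrn//.
by rewrite ler_powR ?(ltW a1)// -ler_pdivrMl// mulrC.
Qed.

End ExpInequalities.

Section PsiNorm.
Local Open Scope ereal_scope.
Context {R : realType}.
Variable beta : R.
Hypothesis beta_gt0 : (0 < beta)%R.

(** The integrand in the definition of [psi_norm], without the - 1. *)
Definition orlicz (c : R) (x : \bar R) : \bar R :=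
  expeR ((`|x| * (c^-1)%:E) `^ beta).

Lemma orlicz_EFin c (x : R) : (0 < c)%R ->
  orlicz c x%:E = (expR ((`|x| / c) `^ beta))%:E.
Proof. by []. Qed.

Lemma orlicz_abs_infty c (x : \bar R) : (0 < c)%R -> x \isn't a fin_num ->
  orlicz c x = +oo.
Proof.
move=> c0 xoo.
have {xoo}xy : `|x| = +oo by move: x xoo => [x| |].
by rewrite /orlicz xy gt0_mulye ?lte_fin ?invr_gt0// poweRyr// gt_eqF.
Qed.

Lemma orlicz_ge1 c (x : \bar R) : 1 <= orlicz c x.
Proof.
by rewrite -[leLHS]expeR0 lee_expeR poweR_ge0.
Qed.

Lemma orlicz_ge0 c (x : \bar R) : 0 <= orlicz c x.
Proof. exact: expeR_ge0. Qed.

Lemma orlicz_subr1_ge0 c (x : \bar R) : 0 <= orlicz c x - 1.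
Proof. by rewrite suber_ge0// orlicz_ge1. Qed.

Lemma le_orlicz c c' (x x' : \bar R) : (0 < c <= c')%R -> `|x| <= `|x'| ->
  orlicz c' x <= orlicz c x'.
Proof.
move=> /andP[c0 cc'] xx'; have c'0 := lt_le_trans c0 cc'.
have pos (z : \bar R) (e : R) : (0 < e)%R -> `|z| * (e^-1)%:E \in `[0, +oo].
  by move=> e0; rewrite in_itv/= leey mule_ge0// lee_fin invr_ge0 ltW.
rewrite lee_expeR; apply: (gt0_ler_poweR (ltW beta_gt0)); rewrite ?pos//.
by apply: lee_pmul => //; rewrite lee_fin ?lef_pV2// invr_ge0 ltW.
Qed.

Lemma measurable_orlicz c : (0 < c)%R ->
  measurable_fun [set: \bar R] (orlicz c).
Proof.
move=> c0.
rewrite (_ : orlicz c = fun x => if x \is a fin_num then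
   (expR ((`|fine x| / c) `^ beta))%:E else +oo); last first.
  apply/funext => x; case: ifPn => [xfin|/orlicz_abs_infty ->//].
  by rewrite -orlicz_EFin// fineK.
apply: measurable_fun_ifT => //.
- apply: (measurable_fun_bool true).
  rewrite (_ : _ @^-1` _ = [set x : \bar R | x \is a fin_num]).
    exact: (@emeasurable_fin_num _ (\bar R) R setT id measurableT
      (@measurable_id _ _ _)).
  by apply/seteqP; split.
- apply/measurable_EFinP; apply: measurableT_comp => //.
  apply: (measurableT_comp (measurable_powR beta)).
  apply: measurable_funM => //.
  exact: measurableT_comp.
Qed.

Context {dO : measure_display} {Omega : measurableType dO}.
Variable P : probability Omega R.

(** The infimum defining the norm need not be attained, hence the strict
    inequality: some admissible constant lies below [c], and admissibility is
    monotone. *)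
Lemma psi_norm_lt (xi : Omega -> \bar R) (c : R) :
  measurable_fun [set: Omega] xi -> psi_norm P beta xi < c%:E ->
  (0 < c)%R /\ \int[P]_w (orlicz c (xi w) - 1) <= 1.
Proof.
move=> mxi /ereal_inf_lt[_ [C /= [C0 IC] <-]]; rewrite lte_fin => Cc.
have c0 := lt_trans C0 Cc; split; first by [].
apply: le_trans IC.
have mo (c1 : R) : (0 < c1)%R ->
    measurable_fun [set: Omega] (fun w => orlicz c1 (xi w) - 1).
  move=> c10; apply: emeasurable_funB => //.
  exact: (measurableT_comp (measurable_orlicz c10)).
apply: ge0_le_integral => //.
- by move=> w _; exact: orlicz_subr1_ge0.
- exact: mo.
- exact: mo.
- by move=> w _; apply: leeD => //; rewrite le_orlicz// C0 ltW.
Qed.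

Lemma psi_norm_orlicz (xi : Omega -> \bar R) (c : R) :
  measurable_fun [set: Omega] xi -> psi_norm P beta xi < c%:E ->
  (0 < c)%R /\ \int[P]_w orlicz c (xi w) <= 2%:E.
Proof.
move=> mxi xic; have [c0 I1] := psi_norm_lt mxi xic; split => //.
have mo : measurable_fun [set: Omega] (fun w => orlicz c (xi w)).
  exact: (measurableT_comp (measurable_orlicz c0)).
rewrite (_ : (fun w => orlicz c (xi w)) =
             fun w => (orlicz c (xi w) - 1) + 1); last first.
  by apply/funext => w; rewrite subeK.
rewrite ge0_integralD//; last 2 first.
  by move=> w _; exact: orlicz_subr1_ge0.
  exact: emeasurable_funB.
rewrite integral_cst// mul1e [X in _ + X]probability_setT.
by rewrite -[2%:E]/((1 + 1)%R%:E) EFinD leeD.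
Qed.

Lemma orlicz_tail (xi : Omega -> \bar R) (c t : R) :
  measurable_fun [set: Omega] xi -> (0 < c)%R -> (0 <= t)%R ->
  \int[P]_w orlicz c (xi w) <= 2%:E ->
  P [set w | (c * t)%:E < `|xi w|] <= (2 * expR (- (t `^ beta)))%:E.
Proof.
move=> mxi c0 t0 I2.
have mA : measurable [set w | (c * t)%:E < `|xi w|].
  rewrite -[X in measurable X]setTI; apply: emeasurable_fun_o_infty => //.
  exact: measurableT_comp.
rewrite -(setIT [set w | _]) -integral_indic//.
apply: (@le_trans _ _
    (\int[P]_w ((expR (- (t `^ beta)))%:E * orlicz c (xi w)))).
  apply: ge0_le_integral => //.
  - exact/measurable_EFinP/measurable_indic.
  - apply: emeasurable_funM => //.
    exact: (measurableT_comp (measurable_orlicz c0)).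
  - move=> w _; rewrite indicE; have [|_] := boolP (w \in _); last first.
      by rewrite mule_ge0// ?lee_fin ?expR_ge0// orlicz_ge0.
    rewrite inE /= => ltxi.
    have : orlicz c (c * t)%:E <= orlicz c (xi w).
      rewrite le_orlicz//; first by rewrite c0 lexx.
      by rewrite gee0_abs ?lee_fin ?mulr_ge0 ?(ltW c0)// ltW.
    rewrite orlicz_EFin// ger0_norm; last by rewrite mulr_ge0// ltW.
    rewrite [(c * t)%R]mulrC mulfK ?gt_eqF// => H.
    apply: le_trans (lee_wpmul2l _ H); last by rewrite lee_fin expR_ge0.
    by rewrite -EFinM lee_fin expRN mulVf// gt_eqF ?expR_gt0.
rewrite ge0_integralZl//; last 2 first.
- exact: (measurableT_comp (measurable_orlicz c0)).
- by move=> w _; exact: orlicz_ge0.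
by rewrite mulrC EFinM lee_wpmul2l// lee_fin expR_ge0.
Qed.

End PsiNorm.

(** * The conditional norm of a kernel *)

Section KernelNorm.
Local Open Scope ereal_scope.
Context {dO : measure_display} {Omega : measurableType dO} {R : realType}.
Variable P : probability Omega R.
Context {dT : measure_display} {T : measurableType dT}.
Context {dS' : measure_display} {S' : measurableType dS'}.
Variable W : {RV P >-> S'}.

Lemma measurable_integral_mark (g : T * S' -> \bar R) :
  measurable_fun [set: T * S'] g -> (forall z, 0 <= g z) ->
  measurable_fun [set: T] (fun x => \int[P]_w g (x, W w)).
Proof.
move=> mg g0.
have mgx x : measurable_fun [set: S'] (fun s => g (x, s)).
  exact: measurableT_comp.
rewrite (_ : (fun x => _) = fubini_F (distribution P W) g).
  exact: measurable_fun_fubini_tonelli_F.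
by apply/funext => x; rewrite /fubini_F ge0_integral_distribution.
Qed.

Lemma measurable_mean_mark (g : T * S' -> R) :
  measurable_fun [set: T * S'] g ->
  measurable_fun [set: T] (fun x => fine 'E_P[fun w => g (x, W w)]).
Proof.
move=> mg; apply: (measurableT_comp (fine_measurable measurableT)).
rewrite (_ : (fun x => _) = fun x =>
    \int[P]_w ((EFin \o g)^\+ (x, W w)) - \int[P]_w ((EFin \o g)^\- (x, W w))).
  have mEg : measurable_fun [set: T * S'] (EFin \o g) by exact/measurable_EFinP.
  apply: emeasurable_funB; apply: measurable_integral_mark => //.
    exact: measurable_funepos.
  exact: measurable_funeneg.
apply/funext => x; rewrite unlock [LHS]integralE.
by congr (_ - _); apply: eq_integral => w _; rewrite ?funeposE ?funenegE.
Qed.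

Variable beta : R.
Hypothesis beta_gt0 : (0 < beta)%R.

Section CondNorm.
Variable y : T * S' -> R.
Hypothesis my : measurable_fun [set: T * S'] y.

(** The psi_beta norm of y(x, W) for a frozen argument x; for y = F_j - f_j
    this unfolds to [kernel_b]. *)
Definition cond_norm (x : T) : \bar R :=
  psi_norm P beta (fun w => (y (x, W w))%:E).

Lemma measurable_section x :
  measurable_fun [set: Omega] (fun w => (y (x, W w))%:E).
Proof.
apply/measurable_EFinP.
have myx : measurable_fun [set: S'] (fun s => y (x, s)).
  exact: measurableT_comp.
exact: (measurableT_comp myx (measurable_funP W)).
Qed.

(** Restricting the admissible constants to rational numbers turns the sublevel
    sets of the conditional norm into countable unions, whence their
    measurability. *)
Lemma cond_norm_lt x (c : R) : cond_norm x < c%:E <->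
  exists q : rat, (0 < (ratr q : R) < c)%R /\
    \int[P]_w (orlicz beta (ratr q) (y (x, W w))%:E - 1) <= 1.
Proof.
split.
  move=> xc; have [_ [C /= [C0 IC] <-]] := ereal_inf_lt xc.
  rewrite lte_fin => /rat_in_itvoo[q]; rewrite in_itv/= => /andP[Cq qc].
  have q0 := lt_trans C0 Cq; exists q; split; first by apply/andP; split.
  apply: (psi_norm_lt beta_gt0 (measurable_section x) _).2.
  apply: (@le_lt_trans _ _ C%:E); last by rewrite lte_fin.
  by apply: ereal_inf_lbound; exists C.
move=> [q [/andP[q0 qc] Iq]].
apply: (@le_lt_trans _ _ (ratr q)%:E); last by rewrite lte_fin.
by apply: ereal_inf_lbound; exists (ratr q).
Qed.

Lemma measurable_cond_norm : measurable_fun [set: T] cond_norm.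
Proof.
apply: (measurability _ (ErealGenInftyO.measurableE R)).
move=> _ [_ [c ->] <-]; rewrite setTI.
rewrite (_ : _ @^-1` _ = \bigcup_(q : rat) (if (0 < (ratr q : R) < c)%R then
   [set x | \int[P]_w (orlicz beta (ratr q) (y (x, W w))%:E - 1) <= 1]
   else set0)); last first.
  apply/seteqP; split => x /=.
    rewrite in_itv/= => /cond_norm_lt[q [qc Iq]]; exists q => //.
    by rewrite qc.
  move=> [q _]; case: ifPn => // qc Iq.
  by rewrite in_itv/=; apply/cond_norm_lt; exists q.
apply: bigcupT_measurable_rat => q; case: ifPn => // /andP[q0 _].
rewrite -[X in measurable X]setTI; apply: emeasurable_fun_infty_c => //.
apply: (@measurable_integral_mark (fun z => orlicz beta (ratr q) (y z)%:E - 1)).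
  apply: emeasurable_funB => //.
  apply: (measurableT_comp (measurable_orlicz beta_gt0 q0)).
  exact/measurable_EFinP.
by move=> z; exact: orlicz_subr1_ge0.
Qed.

Lemma cond_norm_ge0 x : 0 <= cond_norm x.
Proof.
by apply: le_ereal_inf_tmp => _ [C [/= C0 _] <-]; rewrite lee_fin ltW.
Qed.

End CondNorm.

Lemma orlicz_integrable (xi : Omega -> R) (c : R) :
  measurable_fun [set: Omega] xi -> (0 < c)%R ->
  \int[P]_w orlicz beta c (xi w)%:E <= 2%:E ->
  P.-integrable [set: Omega] (fun w => (xi w)%:E).
Proof.
move=> mxi c0 I2.
have [K K1 HK] := sqr_le_expR_powR beta_gt0.
apply: (@le_integrable _ _ _ P _ measurableT _
   (fun w => (c * (1 + K))%:E * orlicz beta c (xi w)%:E)).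
- exact/measurable_EFinP.
- move=> w _; rewrite orlicz_EFin// -EFinM !abse_EFin lee_fin.
  rewrite [leRHS]ger0_norm; last first.
    by rewrite mulr_ge0 ?expR_ge0// mulr_ge0 ?ltW//; lra.
  set a := (`|xi w| / c)%R.
  have a0 : (0 <= a)%R by rewrite divr_ge0// ltW.
  have -> : `|xi w|%R = (c * a)%R by rewrite mulrC divfK ?gt_eqF.
  rewrite -mulrA ler_wpM2l ?(ltW c0)//.
  have e1 : (1 <= expR (a `^ beta))%R by rewrite -expR0 ler_expR powR_ge0.
  have e2 : (expR (a `^ beta / 2) <= expR (a `^ beta))%R.
    by rewrite ler_expR; have := powR_ge0 a beta; lra.
  apply: (@le_trans _ _ (1 + a ^+ 2)%R); first by rewrite expr2; nra.
  rewrite mulrDl mul1r lerD// (le_trans (HK _ a0))//.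
  by rewrite ler_wpM2l//; lra.
- have mo : measurable_fun [set: Omega] (fun w => orlicz beta c (xi w)%:E).
    apply: (measurableT_comp (measurable_orlicz beta_gt0 c0)).
    exact/measurable_EFinP.
  apply: integrableZl => //; apply/integrableP; split => //.
  under eq_integral do rewrite gee0_abs ?orlicz_ge0//.
  exact: le_lt_trans I2 (ltry _).
Qed.

(** A finite norm forces F_j(x, W) to be integrable, so that [fine] in the
    definition of f_j returns its actual expectation. *)
Lemma cond_norm_centered (g : T * S' -> R) (x : T) :
  measurable_fun [set: T * S'] g ->
  let f x := fine 'E_P[fun w => g (x, W w)] in
  let y z := (g z - f z.1)%R in
  cond_norm y x < +oo ->
  P.-integrable [set: Omega] (fun w => (y (x, W w))%:E) /\
  \int[P]_w (y (x, W w))%:E = 0.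
Proof.
move=> mg f y xoo.
have mf : measurable_fun [set: T] f by exact: measurable_mean_mark.
have my : measurable_fun [set: T * S'] y.
  by apply: measurable_funB => //; exact: measurableT_comp.
have [c xc] : exists c : R, cond_norm y x < c%:E.
  exists (fine (cond_norm y x) + 1)%R.
  rewrite EFinD fineK ?ge0_fin_numE ?cond_norm_ge0//.
  by rewrite lteDl ?ge0_fin_numE ?cond_norm_ge0.
have [c0 I2] := psi_norm_orlicz beta_gt0 (measurable_section my x) xc.
have iy : P.-integrable [set: Omega] (fun w => (y (x, W w))%:E).
  apply: (orlicz_integrable _ c0 I2); apply/measurable_EFinP.
  exact: measurable_section.
split => //.
have ifx : P.-integrable [set: Omega] (EFin \o cst (f x)).
  exact: finite_measure_integrable_cst.
have ig : P.-integrable [set: Omega] (fun w => (g (x, W w))%:E).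
  rewrite (_ : (fun w => _) =
    (fun w => (y (x, W w))%:E) \+ (EFin \o cst (f x))).
    exact: integrableD.
  by apply/funext => w /=; rewrite -EFinD subrK.
rewrite /y; under eq_integral do rewrite EFinB.
rewrite (@integralB_EFin _ _ _ P _ _ (cst (f x)))//=.
have -> : \int[P]_w (f x)%:E = (f x)%:E.
  by rewrite integral_cst//= [X in _ * X]probability_setT mule1.
rewrite /f unlock fineK; last exact: integrable_fin_num.
by rewrite subee// integrable_fin_num.
Qed.

Lemma orlicz_sqr_integral (K : R) (xi : Omega -> R) (c : R) :
  (forall a, 0 <= a -> a ^+ 2 <= K * expR (a `^ beta / 2))%R -> (0 <= K)%R ->
  measurable_fun [set: Omega] xi -> (0 < c)%R ->
  \int[P]_w orlicz beta c (xi w)%:E <= 2%:E ->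
  \int[P]_w ((xi w / c) ^+ 2)%:E <= (2 * K)%:E.
Proof.
move=> HK K0 mxi c0 I2.
have mo : measurable_fun [set: Omega] (fun w => orlicz beta c (xi w)%:E).
  apply: (measurableT_comp (measurable_orlicz beta_gt0 c0)).
  exact/measurable_EFinP.
apply: (@le_trans _ _ (\int[P]_w (K%:E * orlicz beta c (xi w)%:E))).
  apply: ge0_le_integral => //.
  - by move=> w _; rewrite lee_fin sqr_ge0.
  - apply/measurable_EFinP; apply: measurable_funX; exact: measurable_funM.
  - exact: emeasurable_funM.
  - move=> w _; rewrite orlicz_EFin// -EFinM lee_fin.
    rewrite -[leLHS]ger0_norm ?sqr_ge0// normrX normrM normfV (gtr0_norm c0).
    have a0 : (0 <= `|xi w| / c)%R by rewrite divr_ge0// ltW.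
    apply: le_trans (HK _ a0) _; rewrite ler_wpM2l// ler_expR.
    by have := powR_ge0 (`|xi w| / c) beta; lra.
rewrite ge0_integralZl//; last by move=> w _; exact: orlicz_ge0.
by rewrite mulrC EFinM lee_wpmul2l.
Qed.

End KernelNorm.

(** * Permutations and increasing tuples *)

Section PermutationAverage.
Variables (n r : nat).

Lemma uniq_tuple_transitive (kappa iota : r.-tuple 'I_n) :
  (r <= n)%N -> uniq kappa -> uniq iota ->
  exists s : 'S_n, map_tuple s kappa = iota.
Proof.
move=> rn uk ui.
have tr : ntransitive r 'Sym_('I_n)%g finset.setT ('P)%act.
  apply: (ntransitive_weak (m := #|'I_n|)); first by rewrite card_ord.
  exact: Sym_trans.
have dk (t : r.-tuple 'I_n) : uniq t -> t \in dtuple_on r finset.setT.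
  by move=> ut; rewrite inE ut; apply/fintype.subsetP => k; rewrite inE.
have [s _ ->] := atransP2 tr (dk _ uk) (dk _ ui).
by exists s; apply/val_inj.
Qed.


Lemma incr_index_uniq (iota : incr_index n r) : uniq (val iota).
Proof.
have := valP iota; rewrite ltn_sorted_uniq_leq => /andP[+ _].
exact: map_uniq.
Qed.

Definition ord_leq : rel 'I_n := fun i j => (i <= j)%N.

Lemma ord_leq_total : total ord_leq.
Proof. by move=> i j; exact: leq_total. Qed.

Lemma ord_leq_trans : transitive ord_leq.
Proof. by move=> i j k; exact: leq_trans. Qed.

Lemma ord_leq_anti : antisymmetric ord_leq.
Proof. by move=> i j /anti_leq; exact: val_inj. Qed.

Lemma incr_index_sorted (iota : incr_index n r) : sorted ord_leq (val iota).
Proof.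
by have := valP iota; rewrite ltn_sorted_uniq_leq sorted_map => /andP[].
Qed.

(** The action of permutations on r-subsets, a subset being encoded by its
    increasing enumeration. *)
Definition perm_incr (s : 'S_n) (iota : incr_index n r) : incr_index n r :=
  insubd iota (sort_tuple ord_leq (map_tuple s (val iota))).

Lemma val_perm_incr s iota :
  perm_eq (val (perm_incr s iota)) (map_tuple s (val iota)).
Proof.
rewrite val_insubd ifT; first by rewrite /= perm_sort.
rewrite ltn_sorted_uniq_leq sorted_map (sort_sorted ord_leq_total) andbT.
rewrite (map_inj_uniq val_inj) sort_uniq (map_inj_uniq (@perm_inj _ s)).
exact: incr_index_uniq.
Qed.

Lemma perm_incr_inj s : injective (perm_incr s).
Proof.
move=> i j ij; apply/val_inj/val_inj.
apply: (sorted_eq ord_leq_trans ord_leq_anti); try exact: incr_index_sorted.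
apply: (perm_map_inj (@perm_inj _ s)).
have := val_perm_incr s i; rewrite perm_sym ij => /perm_trans; apply.
exact: val_perm_incr.
Qed.

(** Both sides equal the sum of f over all images of all increasing tuples.
    Exchanging the two sums, the inner sum over permutations is the same for
    every tuple of distinct indices, by transitivity; the inner sum over
    increasing tuples is the same for every permutation, which only permutes
    the subsets. *)
Lemma sum_perm_incr_index (R : pzSemiRingType) (f : r.-tuple 'I_n -> R)
    (kappa : r.-tuple 'I_n) :
  (forall t t' : r.-tuple 'I_n, perm_eq t t' -> f t = f t') ->
  (r <= n)%N -> uniq kappa ->
  #|{: incr_index n r}|%:R * \sum_(s : 'S_n) f (map_tuple s kappa) =
  #|{: 'S_n}|%:R * \sum_(iota : incr_index n r) f (val iota).
Proof.
move=> fsym rn uk.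
transitivity (\sum_(iota : incr_index n r) \sum_(s : 'S_n)
    f (map_tuple s (val iota))).
  rewrite mulr_natl -sumr_const; apply: eq_bigr => iota _.
  have [t <-] := uniq_tuple_transitive rn uk (incr_index_uniq iota).
  rewrite (reindex_inj (mulgI t)); apply: eq_bigr => s _; congr f.
  by apply/val_inj; rewrite /= -map_comp; apply: eq_map => i /=; rewrite permM.
rewrite exchange_big mulr_natl -sumr_const; apply: eq_bigr => s _.
rewrite [RHS](reindex_inj (perm_incr_inj (s := s))); apply: eq_bigr => iota _.
by apply: fsym; rewrite perm_sym val_perm_incr.
Qed.

Lemma card_incr_index_gt0 : (r <= n)%N -> (0 < #|{: incr_index n r}|)%N.
Proof.
move=> rn; apply/card_gt0P.
have srt : sorted ltn [seq val i | i <- [tuple widen_ord rn k | k < r]].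
  rewrite (_ : [seq _ | _ <- _] = iota 0 r) ?iota_ltn_sorted//.
  by rewrite /= -map_comp -[RHS]val_enum_ord; exact: eq_map.
by exists (exist _ [tuple widen_ord rn k | k < r] srt).
Qed.

Lemma card_incr_index_le : (#|{: incr_index n r}| <= n ^ r)%N.
Proof.
rewrite -[in leqRHS](card_ord n) -card_tuple.
exact: leq_card val_inj.
Qed.

End PermutationAverage.

(** * Exponential moments of U-statistics *)

(** Jensen's inequality, from the tangent line of exp at the average. *)
Lemma expR_jensen {R : realType} (I : finType) (a : I -> R) :
  (0 < #|I|)%N ->
  expR ((#|I|%:R)^-1 * \sum_i a i) <= (#|I|%:R)^-1 * \sum_i expR (a i).
Proof.
move=> I0; have c0 : 0 < #|I|%:R :> R by rewrite ltr0n.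
set avg := _^-1 * _.
rewrite ler_pdivlMl//.
have sum0 : \sum_i (a i - avg) = 0.
  rewrite big_split/= sumrN sumr_const /avg -[X in _ - X]mulr_natl.
  by rewrite mulrA divff ?gt_eqF// mul1r subrr.
apply: (@le_trans _ _ (\sum_i expR avg * (1 + (a i - avg)))).
  rewrite -mulr_sumr big_split/= sum0 addr0 sumr_const.
  by rewrite mulrC.
apply: ler_sum => i _; have -> : expR (a i) = expR avg * expR (a i - avg).
  by rewrite -expRD addrC subrK.
by rewrite ler_wpM2l ?expR_ge0// expR_ge1Dx.
Qed.

Section Blocks.
Variables (n r m : nat).
Hypothesis mrn : (m * r <= n)%N.

Lemma block_subproof (k : 'I_m) (i : 'I_r) : (k * r + i < n)%N.
Proof.
apply: leq_trans mrn; apply: (@leq_trans (k.+1 * r)%N).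
  by rewrite mulSn addnC ltn_add2r.
by rewrite leq_mul2r ltn_ord orbT.
Qed.

(** The indices k r, ..., k r + r - 1: the m blocks involve disjoint sets of
    variables. *)
Definition block (k : 'I_m) : r.-tuple 'I_n :=
  [tuple Ordinal (block_subproof k i) | i < r].

Lemma block_inj (k l : 'I_m) (i j : 'I_r) :
  tnth (block k) i = tnth (block l) j -> k = l /\ i = j.
Proof.
rewrite !tnth_mktuple => /(congr1 val)/= e.
have r0 : (0 < r)%N by apply: leq_ltn_trans (ltn_ord i).
split; apply/val_inj => /=.
  have := congr1 (divn^~ r) e.
  by rewrite !divnMDl// !divn_small// !addn0.
have := congr1 (modn^~ r) e.
by rewrite !modnMDl !modn_small.
Qed.

Lemma block_uniq k : uniq (block k).
Proof. by apply/tuple_uniqP => i j /block_inj[]. Qed.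

Lemma block_disjoint (k l : 'I_m) x : x \in block k -> x \in block l -> k = l.
Proof. by move=> /tnthP[i ->] /tnthP[j] /block_inj[]. Qed.

End Blocks.

Section UStatistic.
Local Open Scope ereal_scope.
Context {dO : measure_display} {Omega : measurableType dO} {R : realType}.
Variable P : probability Omega R.
Context {dS : measure_display} {S : measurableType dS}.
Variables (n r : nat) (X : 'I_n -> {RV P >-> S}).
Hypothesis Xiid : iid X.
Hypothesis rn : (r <= n)%N.

Definition symmetric_fun {V} (h : r.-tuple S -> V) :=
  forall (s : 'S_r) x, h [tuple tnth x (s k) | k < r] = h x.

Definition ustat (h : r.-tuple S -> R) (w : Omega) : R :=
  ((#|{: incr_index n r}|%:R)^-1 *
   \sum_(iota : incr_index n r) h (X_at X (val iota) w))%R.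

Variable h : r.-tuple S -> R.
Hypothesis mh : measurable_fun [set: r.-tuple S] h.
Hypothesis hsym : symmetric_fun h.

Lemma symmetric_X_at (t t' : r.-tuple 'I_n) w : perm_eq t t' ->
  h (X_at X t w) = h (X_at X t' w).
Proof.
move=> /tuple_permP[p tp].
rewrite -[RHS](hsym p); congr h; apply: eq_from_tnth => i.
rewrite !tnth_mktuple; congr (X _ w).
rewrite (_ : t = [tuple tnth t' (p i) | i < r]) ?tnth_mktuple//.
exact/val_inj.
Qed.

Lemma measurable_ustat : measurable_fun [set: Omega] (ustat h).
Proof.
apply: measurable_funM => //; apply: measurable_sum => iota.
by apply: measurableT_comp => //; exact: measurable_X_at.
Qed.

Variables (m : nat) (lam a : R) (kappa : r.-tuple 'I_n).
Hypothesis mrn : (m * r <= n)%N.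
Hypothesis kappa_uniq : uniq kappa.

(** Hoeffding's representation: the U-statistic is the average over all
    permutations of the mean of h over the permuted blocks. *)
Lemma expR_ustat_le w :
  (expR (lam * (m%:R * ustat h w)) <= (#|{: 'S_n}|%:R)^-1 *
     \sum_(s : 'S_n) \prod_(k < m)
        expR (lam * h (X_at X (map_tuple s (block mrn k)) w)))%R.
Proof.
have S0 : (0 < #|{: 'S_n}|)%N by apply/card_gt0P; exists 1%g.
have N0 : (#|{: incr_index n r}|%:R != 0 :> R)%R.
  by rewrite pnatr_eq0 -lt0n card_incr_index_gt0.
pose c s := (\sum_(k < m) lam * h (X_at X (map_tuple s (block mrn k)) w))%R.
have -> : (lam * (m%:R * ustat h w) =
           (#|{: 'S_n}|%:R)^-1 * \sum_(s : 'S_n) c s)%R.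
  rewrite /c exchange_big/=.
  under eq_bigr => k _.
    rewrite -mulr_sumr.
    have := sum_perm_incr_index (fun t t' tt' => @symmetric_X_at t t' w tt') rn
      (block_uniq mrn k).
    move=> /(congr1 (fun z => lam * (#|{: incr_index n r}|%:R^-1 * z)))%R.
    rewrite mulKf// => ->; over.
  rewrite sumr_const card_ord /ustat -[X in (_ = _ * X)%R]mulr_natr.
  have S0' : (#|{: 'S_n}|%:R != 0 :> R)%R by rewrite pnatr_eq0 -lt0n.
  by field; rewrite N0 S0'.
apply: le_trans (expR_jensen _ S0) _.
rewrite ler_wpM2l ?invr_ge0//; apply: ler_sum => s _.
by rewrite /c expR_sum.
Qed.

(** For a fixed permutation the blocks are disjoint, so the expectation of the
    product factors into m equal terms. *)
Lemma ustat_expectation :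
  \int[P]_w (expR (lam * h (X_at X kappa w)))%:E <= a%:E ->
  \int[P]_w (expR (lam * (m%:R * ustat h w)))%:E <= (a ^+ m)%:E.
Proof.
move=> ha.
pose e x := (expR (lam * h x))%:E.
have me : measurable_fun [set: r.-tuple S] e.
  apply/measurable_EFinP; apply: measurableT_comp => //.
  exact: measurable_funM.
have e0 x : 0 <= e x by rewrite lee_fin expR_ge0.
have meX t : measurable_fun [set: Omega] (fun w => e (X_at X t w)).
  by apply: (measurableT_comp me); exact: measurable_X_at.
set v := \int[P]_w _ in ha.
have v0 : 0 <= v by apply: integral_ge0 => w _; exact: e0.
have vfin : v \is a fin_num by rewrite ge0_fin_numE// (le_lt_trans ha) ?ltry.
have ma : measurable_fun [set: Omega] (fun w =>
    (expR (lam * (m%:R * ustat h w)))%:E).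
  apply/measurable_EFinP; apply: measurableT_comp => //.
  by do 2!apply: measurable_funM => //; exact: measurable_ustat.
pose E (s : 'S_n) w := \prod_(k < m) e (X_at X (map_tuple s (block mrn k)) w).
have mE s : measurable_fun [set: Omega] (E s).
  by apply: emeasurable_fun_bigprod => k; exact: meX.
have E0 s w : 0 <= E s w by rewrite prode_ge0.
have IE s : \int[P]_w E s w = (fine v ^+ m)%:E.
  rewrite (@indep_expectation_prod _ _ _ _ _ _ _ X Xiid.1 _ _
    (fun k => [set x | x \in map_tuple s (block mrn k)]%SET)
    (fun k w => e (X_at X (map_tuple s (block mrn k)) w))) //.
  - rewrite (eq_bigr (fun=> (fine v)%:E)); last first.
      move=> k _; rewrite (fineK vfin); apply: (same_law_integral _ me e0).
      apply: X_at_same_law => //.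
      by rewrite (map_inj_uniq (@perm_inj _ s)) block_uniq.
    by rewrite prodEFin prodr_const card_ord.
  - exact: index_enum_uniq.
  - move=> k l _ _ kl x; rewrite !inE => /mapP[y yk ->].
    rewrite mem_map; last exact: perm_inj.
    by apply: contra kl => yl; apply/eqP; exact: block_disjoint yk yl.
  - move=> k; apply: (measurableT_comp me).
    by apply: measurable_coord_X_at => x; rewrite inE.
apply: (@le_trans _ _
   (\int[P]_w ((#|{: 'S_n}|%:R)^-1%:E * \sum_(s : 'S_n) E s w))).
  apply: ge0_le_integral => //.
  - by apply: emeasurable_funM => //; exact: emeasurable_sum.
  - move=> w _; rewrite /E.
    under eq_bigr do rewrite prodEFin.
    by rewrite sumEFin -EFinM lee_fin expR_ustat_le.
rewrite ge0_integralZl//; last 2 first.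
- exact: emeasurable_sum.
- by move=> w _; exact: sume_ge0.
rewrite ge0_integral_sum//; under eq_bigr do rewrite IE.
rewrite sumEFin sumr_const -EFinM lee_fin.
rewrite -[X in (_ * X)%R]mulr_natl mulKf; last first.
  by rewrite pnatr_eq0 -lt0n; apply/card_gt0P; exists 1%g.
rewrite lerXn2r ?nnegrE ?fine_ge0// -?lee_fin ?fineK//.
exact: le_trans v0 ha.
Qed.

End UStatistic.

(** * Tails of the conditional norms *)

Section Markov.
Local Open Scope ereal_scope.
Context {dO : measure_display} {Omega : measurableType dO} {R : realType}.
Variable P : probability Omega R.

Lemma markov_set (A : set Omega) (g : Omega -> \bar R) (c : R) :
  (0 < c)%R -> measurable A -> measurable_fun [set: Omega] g ->
  (forall w, 0 <= g w) -> (forall w, A w -> c%:E <= g w) ->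
  P A <= (c^-1)%:E * \int[P]_w g w.
Proof.
move=> c0 mA mg g0 Ag; rewrite -(setIT A) -integral_indic//.
rewrite -ge0_integralZl//; last by rewrite lee_fin invr_ge0 ltW.
apply: ge0_le_integral => //.
- exact/measurable_EFinP/measurable_indic.
- exact: emeasurable_funM.
- move=> w _; rewrite indicE; have [|_] := boolP (w \in A); last first.
    by rewrite mule_ge0// lee_fin invr_ge0 ltW.
  rewrite inE => /Ag cg; rewrite -[leLHS](_ : (c^-1)%:E * c%:E = _).
    by rewrite lee_wpmul2l// lee_fin invr_ge0 ltW.
  by rewrite -EFinM mulVf ?gt_eqF.
Qed.

Lemma markov_expR (Z : Omega -> R) (A L : R) :
  measurable_fun [set: Omega] Z ->
  \int[P]_w (expR (Z w))%:E <= (expR A)%:E ->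
  P [set w | (A + L < Z w)%R] <= (expR (- L))%:E.
Proof.
move=> mZ ZA.
have mS : measurable [set w | (A + L < Z w)%R].
  rewrite -[X in measurable X]setTI.
  exact: (measurable_fun_ltr (measurable_cst _) mZ).
apply: le_trans (markov_set (g := fun w => (expR (Z w))%:E) (expR_gt0 (A + L))
  mS _ _ _) _.
- by apply/measurable_EFinP; exact: measurableT_comp.
- by move=> w; rewrite lee_fin expR_ge0.
- by move=> w /= /ltW AZ; rewrite lee_fin ler_expR.
rewrite -expRN (_ : expR (- L) = expR (- (A + L)) * expR A)%R; last first.
  by rewrite -expRD; congr expR; ring.
by rewrite EFinM lee_wpmul2l// lee_fin expR_ge0.
Qed.

Lemma union_bound (I : finType) (A : I -> set Omega) (p : R) :
  (forall i, measurable (A i)) -> (forall i, P (A i) <= p%:E) ->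
  measurable [set w | exists i, A i w] /\
  P [set w | exists i, A i w] <= (#|I|%:R * p)%:E.
Proof.
move=> mA Ap.
have -> : [set w | exists i, A i w] = \big[setU/set0]_(i <- index_enum I) A i.
  rewrite -bigcup_seq; apply/seteqP; split => w /=.
    by move=> [i Aiw]; exists i => //=; rewrite mem_index_enum.
  by move=> [i _ Aiw]; exists i.
split; first by apply: bigsetU_measurable.
have mU s : measurable (\big[setU/set0]_(i <- s) A i).
  by apply: bigsetU_measurable.
apply: (@le_trans _ _ (\sum_(i <- index_enum I) p%:E)).
  elim: (index_enum I) => [|i s IHs]; first by rewrite !big_nil measure0.
  rewrite !big_cons; apply: le_trans (measureU2 P (mA i) (mU s)) _.
  by apply: leeD => //; exact: Ap.
by rewrite sumEFin sumr_const mulr_natl.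
Qed.

End Markov.

Section NormStatistics.
Local Open Scope ereal_scope.
Context {dO : measure_display} {Omega : measurableType dO} {R : realType}.
Variable P : probability Omega R.
Context {dS : measure_display} {S : measurableType dS}.
Variables (n r : nat) (X : 'I_n -> {RV P >-> S}).
Hypothesis Xiid : iid X.
Hypothesis rn : (r <= n)%N.
Variable kappa : r.-tuple 'I_n.
Hypothesis kappa_uniq : uniq kappa.
Variables (beta K : R).
Hypothesis beta_gt0 : (0 < beta)%R.
Hypothesis K_ge1 : (1 <= K)%R.
Hypothesis HK : forall a, (0 <= a)%R -> (a ^+ 2 <= K * expR (a `^ beta / 2))%R.
Variables (b : r.-tuple S -> \bar R) (u : R).
Hypothesis mb : measurable_fun [set: r.-tuple S] b.
Hypothesis b_ge0 : forall x, 0 <= b x.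
Hypothesis u_gt0 : (0 < u)%R.
Hypothesis psi_b : psi_norm P beta (fun w => b (X_at X kappa w)) <= u%:E.

Let mbX t : measurable_fun [set: Omega] (fun w => b (X_at X t w)).
Proof. by apply: (measurableT_comp mb); exact: measurable_X_at. Qed.

Let u2_gt0 : (0 < 2 * u)%R. Proof. by rewrite mulr_gt0. Qed.

(** The constant 2u exceeds the norm strictly, so it is admissible. *)
Lemma orlicz_b (t : r.-tuple 'I_n) : uniq t ->
  \int[P]_w orlicz beta (2 * u) (b (X_at X t w)) <= 2%:E.
Proof.
move=> ut.
have psi2 : psi_norm P beta (fun w => b (X_at X kappa w)) < (2 * u)%:E.
  by apply: le_lt_trans psi_b _; rewrite lte_fin ltr_pMl ?ltr1n.
apply: le_trans (psi_norm_orlicz beta_gt0 (mbX kappa) psi2).2.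
rewrite (@same_law_integral _ _ _ P _ _ _ _
  (fun x => orlicz beta (2 * u) (b x)) (X_at_same_law Xiid ut kappa_uniq))//.
- exact: (measurableT_comp (measurable_orlicz beta_gt0 u2_gt0)).
- by move=> x; exact: orlicz_ge0.
Qed.

Lemma max_norm_tail (tau : R) : (0 <= tau)%R ->
  measurable [set w | exists iota : incr_index n r,
      (2 * u * tau)%:E < b (X_at X (val iota) w)] /\
  P [set w | exists iota : incr_index n r,
      (2 * u * tau)%:E < b (X_at X (val iota) w)] <=
  (#|{: incr_index n r}|%:R * (2 * expR (- (tau `^ beta))))%:E.
Proof.
move=> tau0.
apply: (@union_bound _ _ _ P _ (fun iota : incr_index n r =>
  [set w | (2 * u * tau)%:E < b (X_at X (val iota) w)])) => iota.
  rewrite -[X in measurable X]setTI.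
  exact: emeasurable_fun_o_infty.
have := orlicz_tail beta_gt0 (mbX (val iota)) u2_gt0 tau0
  (orlicz_b (incr_index_uniq iota)).
by under [X in P X]eq_set do rewrite gee0_abs//.
Qed.

(** Where b is infinite this is 0; this happens with probability 0, and the
    event of [max_norm_tail] excludes it. *)
Definition scaled (x : r.-tuple S) : R := (fine (b x) / (2 * u))%R.

Lemma scaled_ge0 x : (0 <= scaled x)%R.
Proof. by rewrite divr_ge0 ?fine_ge0// ltW. Qed.

Let measurable_scaled : measurable_fun [set: r.-tuple S] scaled.
Proof.
apply: measurable_funM => //.
exact: (measurableT_comp (fine_measurable measurableT)).
Qed.

Let mscaledX t : measurable_fun [set: Omega] (fun w => scaled (X_at X t w)).
Proof.
by apply: (measurableT_comp measurable_scaled); exact: measurable_X_at.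
Qed.

Lemma orlicz_scaled (t : r.-tuple 'I_n) : uniq t ->
  \int[P]_w orlicz beta 1 (scaled (X_at X t w))%:E <= 2%:E.
Proof.
move=> ut; apply: le_trans (orlicz_b ut).
apply: ge0_le_integral => //.
- by move=> w _; exact: orlicz_ge0.
- apply: (measurableT_comp (measurable_orlicz beta_gt0 ltr01)).
  exact/measurable_EFinP.
- by apply: (measurableT_comp (measurable_orlicz beta_gt0 u2_gt0)).
move=> w _; apply: (@le_trans _ _
    (orlicz beta (2 * u) (fine (b (X_at X t w)))%:E)).
  rewrite !orlicz_EFin// lee_fin ler_expR divr1 /scaled normrM.
  by rewrite [X in (_ * X)%R](gtr0_norm _) ?invr_gt0.
apply: le_orlicz => //; first by rewrite u2_gt0 lexx.
by case: (b _) => [x| |]//=; rewrite normr0 leey.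
Qed.

(** The square is split where [scaled] exceeds T: the bounded part has
    exponential moments, the other one a negligible mean. *)
Definition low_part (T : R) (x : r.-tuple S) : R :=
  if (scaled x <= T)%R then (scaled x ^+ 2)%R else 0%R.

Definition high_part (T : R) (x : r.-tuple S) : R :=
  if (scaled x <= T)%R then 0%R else (scaled x ^+ 2)%R.

Lemma low_high_part T x : (low_part T x + high_part T x = scaled x ^+ 2)%R.
Proof. by rewrite /low_part /high_part; case: ifP; rewrite ?addr0 ?add0r. Qed.

Let measurable_scaled_le T : measurable_fun [set: r.-tuple S]
  (fun x => (scaled x <= T)%R).
Proof. exact: measurable_fun_ler. Qed.

Lemma measurable_low_part T : measurable_fun [set: r.-tuple S] (low_part T).
Proof. by apply: measurable_fun_ifT => //; exact: measurable_funX. Qed.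

Lemma measurable_high_part T : measurable_fun [set: r.-tuple S] (high_part T).
Proof. by apply: measurable_fun_ifT => //; exact: measurable_funX. Qed.

Lemma low_part_ge0 T x : (0 <= low_part T x)%R.
Proof. by rewrite /low_part; case: ifP; rewrite // sqr_ge0. Qed.

Lemma high_part_ge0 T x : (0 <= high_part T x)%R.
Proof. by rewrite /high_part; case: ifP; rewrite // sqr_ge0. Qed.

Lemma low_part_le T x : (low_part T x <= scaled x ^+ 2)%R.
Proof. by rewrite -(low_high_part T) lerDl high_part_ge0. Qed.

Hypothesis bsym : symmetric_fun b.

Lemma scaled_sym : symmetric_fun scaled.
Proof. by move=> s x; rewrite /scaled bsym. Qed.

(** Chernoff's bound at 1/(2 T^2). There the exponent is at most 1/2, exp is
    bounded by an affine function, and the second moment, at most 2K,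
    suffices. *)
Lemma low_part_tail (m : nat) (T L : R) :
  (0 < m)%N -> (m * r <= n)%N -> (0 < T)%R ->
  P [set w | (4 * K + 2 * T ^+ 2 * L / m%:R < ustat X (low_part T) w)%R] <=
  (expR (- L))%:E.
Proof.
move=> m0 mrn T0; have m0' : (0 < m%:R :> R)%R by rewrite ltr0n.
pose lam : R := (2 * T ^+ 2)^-1%R.
have lam0 : (0 < lam)%R by rewrite invr_gt0 mulr_gt0// exprn_gt0.
have mlowX : measurable_fun [set: Omega] (fun w => low_part T (X_at X kappa w)).
  by apply: (measurableT_comp (measurable_low_part T)); exact: measurable_X_at.
have E1 : \int[P]_w (expR (lam * low_part T (X_at X kappa w)))%:E <=
    (expR (4 * lam * K))%:E.
  apply: (@le_trans _ _ (\int[P]_w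
     (1 + (2 * lam)%:E * ((scaled (X_at X kappa w) / 1) ^+ 2)%:E))).
    apply: ge0_le_integral => //.
    - apply/measurable_EFinP; apply: measurableT_comp => //.
      exact: measurable_funM.
    - apply: emeasurable_funD => //; apply: emeasurable_funM => //.
      by apply/measurable_EFinP; apply: measurable_funX; exact: measurable_funM.
    - move=> w _; set x := X_at X kappa w.
      rewrite -EFinM -EFinD lee_fin divr1.
      apply: (@le_trans _ _ (1 + 2 * (lam * low_part T x))%R).
        apply: expR_le_linear.
        rewrite mulr_ge0 ?low_part_ge0 ?(ltW lam0)//=.
        rewrite /lam invfM -mulrA ler_piMr ?invr_ge0//.
        rewrite ler_pdivrMl ?exprn_gt0// mulr1 /low_part.
        case: ifPn => [sT|_]; last by rewrite sqr_ge0.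
        by rewrite ler_sqr ?nnegrE ?scaled_ge0 ?(ltW T0).
      by rewrite mulrA lerD2l ler_wpM2l ?low_part_le// mulr_ge0// ltW.
  rewrite ge0_integralD//; last 2 first.
    by move=> w _; rewrite -EFinM lee_fin mulr_ge0 ?sqr_ge0// mulr_ge0// ltW.
    apply: emeasurable_funM => //.
    by apply/measurable_EFinP; apply: measurable_funX; exact: measurable_funM.
  rewrite integral_cst// mul1e [X in X + _]probability_setT.
  rewrite ge0_integralZl//; last 3 first.
    by apply/measurable_EFinP; apply: measurable_funX; exact: measurable_funM.
    by move=> w _; rewrite lee_fin sqr_ge0.
    by rewrite lee_fin mulr_ge0// ltW.
  have := orlicz_sqr_integral beta_gt0 HK (le_trans ler01 K_ge1)
    (mscaledX kappa) ltr01 (orlicz_scaled kappa_uniq).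
  move=> I2.
  apply: (@le_trans _ _ (1 + (2 * lam)%:E * (2 * K)%:E)).
    by rewrite leeD2l// lee_wpmul2l// lee_fin mulr_ge0// ltW.
  rewrite -EFinM -EFinD lee_fin.
  have -> : (4 * lam * K = 2 * lam * (2 * K))%R by ring.
  exact: expR_ge1Dx.
have lowsym : symmetric_fun (low_part T).
  by move=> s x; rewrite /low_part scaled_sym.
have := ustat_expectation Xiid rn (measurable_low_part T) lowsym mrn
  kappa_uniq E1.
rewrite -expRM_natl => E2.
have mU : measurable_fun [set: Omega]
    (fun w => lam * (m%:R * ustat X (low_part T) w))%R.
  do 2!apply: measurable_funM => //.
  exact: measurable_ustat (measurable_low_part T).
apply: le_trans (markov_expR L mU E2).
rewrite le_eqVlt; apply/orP; left; apply/eqP; congr (P _).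
apply: eq_set => w; rewrite -(@ltr_pM2l _ (lam * m%:R)%R) ?mulr_gt0// mulrA.
congr (is_true (_ < _)%R); by rewrite /lam; field; rewrite !gt_eqF.
Qed.

(** Beyond T the square is at most K exp(a^beta / 2), which is K exp(a^beta)
    exp(- a^beta / 2) with a last factor at most exp(- T^beta / 2); the first
    factor has expectation at most 2K. *)
Lemma high_part_tail (T L : R) : (0 <= T)%R -> (2 * L <= T `^ beta)%R ->
  P [set w | (2 * K < ustat X (high_part T) w)%R] <= (expR (- L))%:E.
Proof.
move=> T0 LT; have K0 : (0 < K)%R by exact: lt_le_trans K_ge1.
have mhX t : measurable_fun [set: Omega] (fun w => high_part T (X_at X t w)).
  by apply: (measurableT_comp (measurable_high_part T)); exact: measurable_X_at.
have Eh (t : r.-tuple 'I_n) : uniq t ->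
    \int[P]_w (high_part T (X_at X t w))%:E <= (2 * K * expR (- L))%:E.
  move=> ut.
  have mo : measurable_fun [set: Omega]
      (fun w => orlicz beta 1 (scaled (X_at X t w))%:E).
    apply: (measurableT_comp (measurable_orlicz beta_gt0 ltr01)).
    exact/measurable_EFinP.
  apply: (@le_trans _ _ (\int[P]_w
     ((K * expR (- L))%:E * orlicz beta 1 (scaled (X_at X t w))%:E))).
    apply: ge0_le_integral => //.
    - by move=> w _; rewrite lee_fin high_part_ge0.
    - exact/measurable_EFinP.
    - exact: emeasurable_funM.
    - move=> w _; set x := X_at X t w.
      rewrite orlicz_EFin// divr1 -EFinM lee_fin /high_part.
      case: ifPn => [_|]; first by rewrite !mulr_ge0 ?expR_ge0// ltW.
      rewrite -ltNge => Ts; apply: le_trans (HK (scaled_ge0 x)) _.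
      rewrite -mulrA ler_wpM2l ?(ltW K0)// -expRD ler_expR.
      rewrite ger0_norm ?scaled_ge0//.
      have : (T `^ beta <= scaled x `^ beta)%R.
        apply: (ge0_ler_powR (ltW beta_gt0)); last exact: ltW.
          by rewrite nnegrE.
        by rewrite nnegrE scaled_ge0.
      lra.
  rewrite ge0_integralZl//; last 2 first.
    by move=> w _; exact: orlicz_ge0.
    by rewrite lee_fin mulr_ge0 ?expR_ge0// ltW.
  rewrite (_ : (2 * K * expR (- L) = K * expR (- L) * 2)%R); last by ring.
  rewrite [in leRHS]EFinM lee_wpmul2l ?orlicz_scaled//.
  by rewrite lee_fin mulr_ge0 ?expR_ge0// ltW.
have N0 : (0 < #|{: incr_index n r}|%:R :> R)%R.
  by rewrite ltr0n card_incr_index_gt0.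
have mU := measurable_ustat X (measurable_high_part T).
have EU : \int[P]_w (ustat X (high_part T) w)%:E <= (2 * K * expR (- L))%:E.
  rewrite /ustat; under eq_integral do rewrite EFinM -sumEFin.
  rewrite ge0_integralZl//; last 2 first.
    by apply: emeasurable_sum => iota; exact/measurable_EFinP.
    by move=> w _; apply: sume_ge0 => iota _; rewrite lee_fin high_part_ge0.
  rewrite ge0_integral_sum//; last 2 first.
    by move=> iota; exact/measurable_EFinP.
    by move=> iota w _; rewrite lee_fin high_part_ge0.
  apply: (@le_trans _ _ ((#|{: incr_index n r}|%:R^-1)%:E *
      (\sum_(iota : incr_index n r) (2 * K * expR (- L))%:E))).
    rewrite lee_wpmul2l ?lee_fin ?invr_ge0 ?(ltW N0)//.
    apply: lee_sum => iota _.
    by apply: Eh; exact: incr_index_uniq.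
  rewrite sumEFin sumr_const -EFinM -[X in (_ * X)%R]mulr_natl.
  by rewrite mulKf// gt_eqF.
have K2 : (0 < 2 * K)%R by rewrite mulr_gt0.
have mS : measurable [set w | (2 * K < ustat X (high_part T) w)%R].
  rewrite -[X in measurable X]setTI.
  exact: (measurable_fun_ltr (measurable_cst _) mU).
apply: le_trans (markov_set P (g := fun w => (ustat X (high_part T) w)%:E)
  K2 mS _ _ _) _.
- exact/measurable_EFinP.
- move=> w; rewrite lee_fin mulr_ge0 ?invr_ge0 ?(ltW N0)//.
  by apply: sumr_ge0 => iota _; exact: high_part_ge0.
- by move=> w /= /ltW.
apply: (@le_trans _ _ (((2 * K)^-1)%:E * (2 * K * expR (- L))%:E)).
  by rewrite lee_wpmul2l// lee_fin invr_ge0 ltW.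
by rewrite -EFinM mulKf// gt_eqF.
Qed.

End NormStatistics.

(** * Tails given the sample *)

Lemma lee_prod {R : realType} (I : Type) (s : seq I) (f g : I -> \bar R) :
  (forall i, 0 <= f i)%E -> (forall i, f i <= g i)%E ->
  (\prod_(i <- s) f i <= \prod_(i <- s) g i)%E.
Proof.
move=> f0 fg; elim: s => [|i s IHs]; first by rewrite !big_nil.
by rewrite !big_cons lee_pmul// prode_ge0.
Qed.

Section ConditionalTails.
Local Open Scope ereal_scope.
Context {dO : measure_display} {Omega : measurableType dO} {R : realType}.
Variable P : probability Omega R.
Context {dS : measure_display} {S : measurableType dS}.
Context {dS' : measure_display} {S' : measurableType dS'}.
Variables (n r : nat) (X : 'I_n -> {RV P >-> S}).
Variables (W : {RV P >-> S'}) (Wi : incr_index n r -> {RV P >-> S'}).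
Hypothesis XW : independent_families X (oapp Wi W).
Hypothesis Wiid : iid (oapp Wi W).

(** Restricting to a set B of samples lets the bounds on the factors depend on
    properties of the sample. *)
Lemma conditional_product_le (I : finType) (e : I -> incr_index n r)
    (B : set (n.-tuple S)) (g : I -> n.-tuple S * S' -> \bar R)
    (q : I -> n.-tuple S -> R) (a : R) :
  injective e -> measurable B -> (0 <= a)%R ->
  (forall i, measurable_fun [set: n.-tuple S * S'] (g i)) ->
  (forall i z, 0 <= g i z) ->
  (forall x i, B x -> \int[P]_v g i (x, W v) <= (q i x)%:E) ->
  (forall x, B x -> (\prod_i q i x <= a)%R) ->
  \int[P]_w ((\1_B (sample X w))%:E *
             \prod_(i : I) g i (sample X w, Wi (e i) w)) <= a%:E.
Proof.
move=> e_inj mB a0 mg g0 gq qa.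
have mg1 i x : measurable_fun [set: S'] (fun s => g i (x, s)).
  exact: measurableT_comp.
have Se_inj : injective (Some \o e) by move=> i j /= [] /e_inj.
have mB1 : measurable_fun [set: n.-tuple S] (fun x => (\1_B x)%:E : \bar R).
  exact/measurable_EFinP.
have B1_ge0 (x : n.-tuple S) : 0 <= (\1_B x)%:E :> \bar R by rewrite lee_fin.
rewrite (conditional_product XW Wiid Se_inj mB1 B1_ge0 mg g0).
apply: (@le_trans _ _ (\int[P]_w (cst a%:E w))); last first.
  by rewrite integral_cst// [X in _ * X]probability_setT mule1.
have le_a w : (\1_B (sample X w))%:E *
    \prod_(i : I) \int[P]_v g i (sample X w, Wi (e i) v) <= a%:E.
  rewrite indicE; have [|_] := boolP (sample X w \in B); last by rewrite mul0e.
  rewrite inE mul1e => Bw.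
  apply: (@le_trans _ _ (\prod_(i : I) (q i (sample X w))%:E)); last first.
    by rewrite prodEFin lee_fin qa.
  apply: lee_prod => i; first exact: integral_ge0.
  apply: le_trans (gq _ i Bw).
  rewrite (@same_law_integral _ _ _ P _ _ (Wi (e i)) W
    (fun s => g i (sample X w, s)))//.
  exact: (Wiid.2 (Some (e i)) None).
apply: ge0_le_integral => //.
- move=> w _; rewrite mule_ge0 ?lee_fin// prode_ge0// => i _.
  exact: integral_ge0.
- apply: emeasurable_funM.
    by apply: (measurableT_comp mB1); exact: measurable_sample.
  apply: emeasurable_fun_bigprod => i.
  have := measurable_integral_mark (Wi (e i)) (mg i) (g0 i).
  by move=> /measurableT_comp; apply; exact: measurable_sample.
Qed.

Variables (beta K : R).
Hypothesis beta_gt0 : (0 < beta)%R.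
Hypothesis K_ge1 : (1 <= K)%R.
Hypothesis HK : forall a, (0 <= a)%R -> (a ^+ 2 <= K * expR (a `^ beta / 2))%R.
Variable y : r.-tuple S * S' -> R.
Hypothesis my : measurable_fun [set: r.-tuple S * S'] y.

Let b := cond_norm W beta y.

Hypothesis y_centered : forall x, b x < +oo ->
  P.-integrable [set: Omega] (fun w => (y (x, W w))%:E) /\
  \int[P]_w (y (x, W w))%:E = 0.

Variables (u M : R).
Hypothesis u_gt0 : (0 < u)%R.

(** Adding u makes the constant positive and strictly larger than the norm,
    hence admissible, even where the norm is 0. *)
Definition shifted_norm (x : r.-tuple S) : R := (fine (b x) + u)%R.

(** [X_at] as a function of the whole sample instead of the outcome. *)
Definition subsample (iota : r.-tuple 'I_n) (x : n.-tuple S) : r.-tuple S :=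
  [tuple tnth x (tnth iota k) | k < r].

Lemma subsample_sample iota w : subsample iota (sample X w) = X_at X iota w.
Proof.
by apply: eq_from_tnth => i; rewrite !tnth_mktuple tnth_ord_tuple.
Qed.

Lemma measurable_subsample iota :
  measurable_fun [set: n.-tuple S] (subsample iota).
Proof.
apply/measurable_fun_tnthP => i.
rewrite (_ : _ \o _ = (@tnth _ _)^~ (tnth iota i)).
  exact: measurable_tnth.
by apply/funext => w; rewrite /= tnth_mktuple.
Qed.

Let mb : measurable_fun [set: r.-tuple S] b.
Proof. exact: measurable_cond_norm. Qed.

Lemma measurable_shifted_norm : measurable_fun [set: r.-tuple S] shifted_norm.
Proof.
apply: measurable_funD => //.
exact: (measurableT_comp (fine_measurable measurableT)).
Qed.

Lemma shifted_norm_gt0 x : (0 < shifted_norm x)%R.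
Proof. by rewrite ltr_wpDl// fine_ge0// cond_norm_ge0. Qed.

Lemma shifted_norm_orlicz x : b x < +oo ->
  \int[P]_w orlicz beta (shifted_norm x) (y (x, W w))%:E <= 2%:E.
Proof.
move=> xoo; apply: (psi_norm_orlicz beta_gt0 (measurable_section W my x) _).2.
rewrite EFinD fineK ?ge0_fin_numE ?cond_norm_ge0//.
by rewrite lteDl ?lte_fin// ge0_fin_numE ?cond_norm_ge0.
Qed.

Let measurable_y_subsample iota (f : R -> R) : measurable_fun [set: R] f ->
  measurable_fun [set: n.-tuple S * S']
    (fun z => f (y (subsample iota z.1, z.2))).
Proof.
move=> mf; apply: (measurableT_comp mf); apply: (measurableT_comp my).
apply/measurable_fun_pair => //.
by apply: (measurableT_comp (measurable_subsample iota)).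
Qed.

Let measurable_shifted_subsample iota :
  measurable_fun [set: n.-tuple S * S']
    (fun z => shifted_norm (subsample iota z.1)).
Proof.
apply: (measurableT_comp measurable_shifted_norm).
by apply: (measurableT_comp (measurable_subsample iota)).
Qed.

(** For a frozen sample this is the Orlicz tail bound for y(x, W). *)
Lemma mark_tail (tau : R) (iota : incr_index n r) : (0 <= tau)%R ->
  let A := [set w | (b (X_at X (val iota) w) <= M%:E)%E /\
     (shifted_norm (X_at X (val iota) w) * tau <
       `|y (X_at X (val iota) w, Wi iota w)|)%R] in
  measurable A /\ P A <= (2 * expR (- (tau `^ beta)))%:E.
Proof.
move=> tau0 A.
pose B := [set x : n.-tuple S | b (subsample (val iota) x) <= M%:E].
have mB : measurable B.
  have mbp := measurableT_comp mb (measurable_subsample (val iota)).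
  by have := emeasurable_fun_infty_c measurableT mbp M%:E; rewrite setTI.
pose D := [set z : n.-tuple S * S' |
  (shifted_norm (subsample (val iota) z.1) * tau <
    `|y (subsample (val iota) z.1, z.2)|)%R].
have mD : measurable D.
  have m1 : measurable_fun [set: n.-tuple S * S']
      (fun z => shifted_norm (subsample (val iota) z.1) * tau)%R.
    exact: measurable_funM.
  have m2 := measurable_y_subsample (val iota) (@normr_measurable R setT).
  rewrite -[X in measurable X]setTI.
  exact: (measurable_fun_ltr m1 m2).
have AE w : (\1_A w)%:E = (\1_B (sample X w))%:E *
    \prod_(i : unit) (\1_D (sample X w, Wi iota w))%:E :> \bar R.
  rewrite big_const card_unit/= mule1 -EFinM; congr EFin.
  rewrite !indicE -natrM mulnb; congr ((_ : bool)%:R).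
  apply/idP/andP => [/set_mem[bA yA]|[/set_mem bB /set_mem yD]].
    by split; apply/mem_set; rewrite /B /D /= subsample_sample.
  by apply/mem_set; move: bB yD; rewrite /B /D /= subsample_sample; split.
have mA : measurable A.
  have mW : measurable_fun [set: Omega] (fun w => (sample X w, Wi iota w)).
    apply/measurable_fun_pair; first exact: measurable_sample.
    exact: measurable_funP.
  have -> : A = (sample X) @^-1` B `&`
      (fun w => (sample X w, Wi iota w)) @^-1` D.
    by apply/seteqP; split => w /=; rewrite /A /B /D /= !subsample_sample.
  apply: measurableI; rewrite -[X in measurable X]setTI.
    exact: measurable_sample.
  exact: mW.
split => //.
rewrite -(setIT A) -integral_indic//.
under eq_integral do rewrite AE.
apply: (conditional_product_le (e := fun=> iota) (g := fun _ z => (\1_D z)%:E)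
   (q := fun _ _ => (2 * expR (- tau `^ beta))%R)) => //.
- by move=> [] [].
- by move=> _; exact/measurable_EFinP.
- move=> x _ Bx; set z := subsample (val iota) x.
  have zoo : b z < +oo by apply: le_lt_trans Bx (ltry _).
  have := orlicz_tail beta_gt0 (measurable_section W my z) (shifted_norm_gt0 z)
    tau0 (shifted_norm_orlicz zoo).
  have mA' : measurable
      [set w | (shifted_norm z * tau)%:E < `|(y (z, W w))%:E|].
    rewrite -[X in measurable X]setTI; apply: emeasurable_fun_o_infty => //.
    by apply: measurableT_comp => //; exact: measurable_section.
  by rewrite -[X in P X]setIT -integral_indic.
- by move=> x _; rewrite big_const card_unit/= mulr1.
Qed.

(** Where y is truncated the integrand vanishes and the quadratic bound is
    still positive, so the quadratic bound can be integrated without truncation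
    and its linear term has mean 0. *)
Lemma weighted_exp_integral (lam tau : R) (sg : R) (x : r.-tuple S) :
  (0 <= lam)%R -> (0 <= tau)%R -> (`|sg| = 1)%R -> b x < +oo ->
  (lam * (tau * shifted_norm x) <= 2^-1)%R ->
  \int[P]_w (if (sg * y (x, W w) <= shifted_norm x * tau)%R
             then expR (lam * (sg * y (x, W w))) else 0)%:E <=
  (expR (4 * K * lam ^+ 2 * shifted_norm x ^+ 2))%:E.
Proof.
move=> lam0 tau0 sg1 xoo lamtau.
have c0 := shifted_norm_gt0 x; set c := shifted_norm x in c0 lamtau *.
have [iy y0] := y_centered xoo.
have mys : measurable_fun [set: Omega] (fun w => y (x, W w)).
  by apply/measurable_EFinP; exact: measurable_section.
have msy : measurable_fun [set: Omega] (fun w => sg * y (x, W w))%R.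
  exact: measurable_funM.
pose q w : R := (1 + lam * sg * y (x, W w) +
                 2 * lam ^+ 2 * c ^+ 2 * (y (x, W w) / c) ^+ 2)%R.
have sg2 : (sg ^+ 2 = 1)%R.
  by rewrite -[LHS]ger0_norm ?sqr_ge0// normrX sg1 expr1n.
have qE w : q w = (1 + lam * (sg * y (x, W w)) +
    2 * (lam * (sg * y (x, W w))) ^+ 2)%R.
  rewrite /q mulrA; congr (_ + _)%R.
  have -> : ((y (x, W w) / c) ^+ 2 = y (x, W w) ^+ 2 / c ^+ 2)%R.
    by rewrite expr_div_n.
  rewrite !exprMn sg2.
  by field; rewrite gt_eqF.
have le_q w : ((if (sg * y (x, W w) <= c * tau)%R
    then expR (lam * (sg * y (x, W w))) else 0) <= q w)%R.
  rewrite qE; case: ifPn => [yc|_].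
    apply: expR_le_quadratic; apply: le_trans lamtau.
    by rewrite ler_wpM2l// [leRHS]mulrC.
  set z := (lam * _)%R.
  have : (0 <= (1 + 2 * z) ^+ 2)%R by apply: sqr_ge0.
  by rewrite !expr2; nra.
have i2 : \int[P]_w ((y (x, W w) / c) ^+ 2)%:E <= (2 * K)%:E.
  exact: (orlicz_sqr_integral beta_gt0 HK (le_trans ler01 K_ge1) mys c0
    (shifted_norm_orlicz xoo)).
have int2 : P.-integrable [set: Omega] (fun w => ((y (x, W w) / c) ^+ 2)%:E).
  apply/integrableP; split.
    by apply/measurable_EFinP; apply: measurable_funX; exact: measurable_funM.
  under eq_integral do rewrite gee0_abs ?lee_fin ?sqr_ge0//.
  exact: le_lt_trans i2 (ltry _).
apply: (@le_trans _ _ (\int[P]_w (q w)%:E)).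
  apply: ge0_le_integral => //.
  - by move=> w _; rewrite lee_fin; case: ifP.
  - apply/measurable_EFinP; apply: measurable_fun_ifT => //.
      exact: measurable_fun_ler.
    by apply: measurableT_comp => //; exact: measurable_funM.
  - apply/measurable_EFinP; rewrite /q.
    apply: measurable_funD.
      by apply: measurable_funD => //; exact: measurable_funM.
    apply: measurable_funM => //; apply: measurable_funX.
    exact: measurable_funM.
  - by move=> w _; rewrite lee_fin.
have i1 : P.-integrable [set: Omega] (fun w => (lam * sg)%:E * (y (x, W w))%:E).
  exact: integrableZl.
have i3 : P.-integrable [set: Omega]
    (fun w => (2 * lam ^+ 2 * c ^+ 2)%:E * ((y (x, W w) / c) ^+ 2)%:E).
  exact: integrableZl.
have i0 : P.-integrable [set: Omega] (cst 1%:E : Omega -> \bar R).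
  exact: finite_measure_integrable_cst.
have -> : (fun w => (q w)%:E) = (fun w => 1 + (lam * sg)%:E * (y (x, W w))%:E +
    (2 * lam ^+ 2 * c ^+ 2)%:E * ((y (x, W w) / c) ^+ 2)%:E).
  by apply/funext => w; rewrite -!EFinM -!EFinD.
rewrite integralD//; last exact: integrableD.
rewrite integralD// !integralZl// y0 mule0 adde0.
rewrite integral_cst// mul1e [X in X + _]probability_setT.
apply: (@le_trans _ _ (1 + (2 * lam ^+ 2 * c ^+ 2)%:E * (2 * K)%:E)).
  rewrite leeD2l// lee_wpmul2l// lee_fin.
  by rewrite !mulr_ge0 ?exprn_ge0// ltW.
rewrite -EFinM -EFinD lee_fin.
have -> : (4 * K * lam ^+ 2 * c ^+ 2 = 2 * lam ^+ 2 * c ^+ 2 * (2 * K))%R.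
  by ring.
exact: expR_ge1Dx.
Qed.

(** Chernoff's bound given the sample, for the sum and its opposite (sg = 1 and
    sg = -1). The excluded event is a superlevel set of the product of the
    weighted exponentials; under the three constraints on the outcome all the
    weights equal 1, and the product is the exponential of the sum. *)
Lemma sum_tail (lam tau sg Q L : R) :
  (0 <= lam)%R -> (0 <= tau)%R -> (`|sg| = 1)%R ->
  (lam * (tau * (M + u)) <= 2^-1)%R ->
  exists bad : set Omega, [/\ measurable bad, P bad <= (expR (- L))%:E &
    forall w, ~ bad w ->
      (forall iota : incr_index n r, b (X_at X (val iota) w) <= M%:E) ->
      (\sum_(iota : incr_index n r)
         shifted_norm (X_at X (val iota) w) ^+ 2 <= Q)%R ->
      (forall iota : incr_index n r, `|y (X_at X (val iota) w, Wi iota w)| <=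
         shifted_norm (X_at X (val iota) w) * tau)%R ->
      (lam * (sg * \sum_(iota : incr_index n r)
         y (X_at X (val iota) w, Wi iota w)) <= 4 * K * lam ^+ 2 * Q + L)%R].
Proof.
move=> lam0 tau0 sg1 lamtau.
pose B := (\bigcap_(iota in [set: incr_index n r])
    [set x : n.-tuple S | b (subsample (val iota) x) <= M%:E]) `&`
  [set x | (\sum_(iota : incr_index n r)
     shifted_norm (subsample (val iota) x) ^+ 2 <= Q)%R].
have mB : measurable B.
  apply: measurableI.
    apply: fin_bigcap_measurable => [|iota _]; first exact: finite_finset.
    have mbp := measurableT_comp mb (measurable_subsample (val iota)).
    by have := emeasurable_fun_infty_c measurableT mbp M%:E; rewrite setTI.
  have ms : measurable_fun [set: n.-tuple S] (fun x =>
      \sum_(iota : incr_index n r) shifted_norm (subsample (val iota) x) ^+ 2)%R.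
    apply: measurable_sum => iota; apply: measurable_funX.
    exact: measurableT_comp measurable_shifted_norm (measurable_subsample _).
  rewrite -[X in measurable X]setTI.
  exact: (measurable_fun_ler ms (measurable_cst _)).
pose g (iota : incr_index n r) (z : n.-tuple S * S') : \bar R :=
  (if (sg * y (subsample (val iota) z.1, z.2) <=
         shifted_norm (subsample (val iota) z.1) * tau)%R
   then expR (lam * (sg * y (subsample (val iota) z.1, z.2))) else 0)%:E.
have mg iota : measurable_fun [set: n.-tuple S * S'] (g iota).
  have msy : measurable_fun [set: n.-tuple S * S']
      (fun z => sg * y (subsample (val iota) z.1, z.2))%R.
    apply: (measurable_y_subsample _ (f := fun t => (sg * t)%R)).
    exact: measurable_funM.
  apply/measurable_EFinP; apply: measurable_fun_ifT => //.
    by apply: measurable_fun_ler => //; exact: measurable_funM.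
  by apply: measurableT_comp => //; exact: measurable_funM.
have g0 iota z : 0 <= g iota z by rewrite lee_fin; case: ifP.
pose G w := (\1_B (sample X w))%:E *
             \prod_(iota : incr_index n r) g iota (sample X w, Wi iota w).
have G0 w : 0 <= G w by rewrite mule_ge0 ?lee_fin// prode_ge0.
have mG : measurable_fun [set: Omega] G.
  apply: emeasurable_funM.
    have mB1 : measurable_fun [set: n.-tuple S] (fun x => (\1_B x)%:E : \bar R).
      exact/measurable_EFinP.
    by apply: (measurableT_comp mB1); exact: measurable_sample.
  apply: emeasurable_fun_bigprod => iota; apply: (measurableT_comp (mg iota)).
  apply/measurable_fun_pair; first exact: measurable_sample.
  exact: measurable_funP.
have IG : \int[P]_w G w <= (expR (4 * K * lam ^+ 2 * Q))%:E.
  apply: (conditional_product_le (e := id) (g := g) (q := fun iota x =>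
    expR (4 * K * lam ^+ 2 * shifted_norm (subsample (val iota) x) ^+ 2))) => //.
    move=> x iota [Bx _]; have bM := Bx iota I.
    have boo : b (subsample (val iota) x) < +oo.
      exact: le_lt_trans bM (ltry _).
    have cM : (lam * (tau * shifted_norm (subsample (val iota) x)) <= 2^-1)%R.
      apply: le_trans lamtau; rewrite ler_wpM2l// ler_wpM2l// lerD2r.
      by rewrite -lee_fin fineK// ge0_fin_numE ?cond_norm_ge0.
    exact: (weighted_exp_integral lam0 tau0 sg1 boo cM).
  move=> x [_ Bx]; rewrite -expR_sum ler_expR -mulr_sumr ler_wpM2l//.
  by rewrite !mulr_ge0// ?sqr_ge0// (le_trans ler01).
pose e : R := expR (4 * K * lam ^+ 2 * Q + L).
exists [set w | e%:E < G w].
have mbad : measurable [set w | e%:E < G w].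
  by have := emeasurable_fun_o_infty measurableT mG e%:E; rewrite setTI.
split => //.
  apply: le_trans (markov_set P (g := G) (expR_gt0 (4 * K * lam ^+ 2 * Q + L))
    mbad mG G0 _) _; first by move=> w /= /ltW.
  rewrite -expRN (_ : expR (- L) = expR (- (4 * K * lam ^+ 2 * Q + L)) *
    expR (4 * K * lam ^+ 2 * Q))%R; last first.
    by rewrite -expRD; congr expR; ring.
  by rewrite [leRHS]EFinM lee_wpmul2l// lee_fin expR_ge0.
move=> w /= /negP; rewrite -leNgt => Ge bM cQ yc.
have Bmem : B (sample X w).
  split; first by move=> iota _; rewrite /= subsample_sample; exact: bM.
  by rewrite /=; under eq_bigr do rewrite subsample_sample.
have Bw : \1_B (sample X w) = 1%R :> R by rewrite indicE (mem_set Bmem).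
move: Ge; rewrite /G Bw mul1e (eq_bigr (fun iota =>
    (expR (lam * (sg * y (X_at X (val iota) w, Wi iota w))))%:E)); last first.
  move=> iota _; rewrite /g /= subsample_sample ifT//.
  apply: le_trans (yc iota); apply: le_trans (ler_norm _) _.
  by rewrite normrM sg1 mul1r.
by rewrite prodEFin -expR_sum lee_fin ler_expR -!mulr_sumr.
Qed.

End ConditionalTails.

(** * Deviation of one coordinate *)

Section Budgets.
Context {R : realFieldType}.

Lemma ustat_budget (K t : R) : 1 <= K ->
  8 * ((4 * K + t) + 2 * K) + 2 <= 50 * K + 8 * t.
Proof. lra. Qed.

Lemma ge1_triple (L x : R) : 1 <= L -> L <= x -> 1 <= 3 * x.
Proof. lra. Qed.

Lemma six_terms (p : R) : p + p + (p + p) + (p + p) <= 6 * p.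
Proof. lra. Qed.

Lemma shift_budget (u v : R) : u * 1 <= v -> 2 * v + u <= 3 * v.
Proof. lra. Qed.

Lemma deviation_budget (K L s p q : R) : L * p <= L * q ->
  2 * K * (L * s) + 2 * (L * (p + s)) <= (2 * K + 2) * (L * s) + 2 * (L * q).
Proof. lra. Qed.

End Budgets.

Section Deviation.
Local Open Scope ereal_scope.
Context {dO : measure_display} {Omega : measurableType dO} {R : realType}.
Variable P : probability Omega R.
Context {dS : measure_display} {S : measurableType dS}.
Context {dS' : measure_display} {S' : measurableType dS'}.
Variables (n r : nat) (X : 'I_n -> {RV P >-> S}).
Variables (W : {RV P >-> S'}) (Wi : incr_index n r -> {RV P >-> S'}).
Hypothesis Xiid : iid X.
Hypothesis XW : independent_families X (oapp Wi W).
Hypothesis Wiid : iid (oapp Wi W).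
Hypothesis r_gt0 : (0 < r)%N.
Hypothesis rn : (r <= n)%N.
Variables (beta K : R).
Hypothesis beta_gt0 : (0 < beta)%R.
Hypothesis K_ge1 : (1 <= K)%R.
Hypothesis HK : forall a, (0 <= a)%R -> (a ^+ 2 <= K * expR (a `^ beta / 2))%R.
Variable y : r.-tuple S * S' -> R.
Hypothesis my : measurable_fun [set: r.-tuple S * S'] y.
Hypothesis y_centered : forall x, cond_norm W beta y x < +oo ->
  P.-integrable [set: Omega] (fun w => (y (x, W w))%:E) /\
  \int[P]_w (y (x, W w))%:E = 0.
Hypothesis bsym : symmetric_fun (cond_norm W beta y).
Variables (kappa : r.-tuple 'I_n) (u L : R).
Hypothesis kappa_uniq : uniq kappa.
Hypothesis u_gt0 : (0 < u)%R.
Hypothesis psi_b :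
  psi_norm P beta (fun w => cond_norm W beta y (X_at X kappa w)) <= u%:E.
Hypothesis L_ge1 : (1 <= L)%R.
Hypothesis nL : (ln n%:R <= L)%R.

Let N : R := (#|{: incr_index n r}|%:R)%R.

Lemma card_incr_index_expR : (N <= expR (r%:R * L))%R.
Proof.
have n0 : (0 < n%:R :> R)%R by rewrite ltr0n (leq_trans r_gt0).
apply: (@le_trans _ _ ((n ^ r)%:R)%R).
  by rewrite ler_nat card_incr_index_le.
rewrite natrX expRM_natl lerXn2r ?nnegrE ?expR_ge0// ?(ltW n0)//.
by rewrite -[leLHS]lnK ?posrE// ler_expR.
Qed.

(** The factor 3 in tau: one r L pays for N <= exp(r L), and the rest covers
    the constant 2 and exp(- L). *)
Lemma union_tail_le (tau : R) : (tau `^ beta = 3 * (r%:R * L))%R ->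
  (N * (2 * expR (- (tau `^ beta))) <= expR (- L))%R.
Proof.
move=> ->; have rL : (L <= r%:R * L)%R.
  by rewrite ler_peMl ?ler1n// (le_trans ler01).
apply: (@le_trans _ _ (expR (r%:R * L) * (2 * expR (- (3 * (r%:R * L)))))%R).
  by rewrite ler_wpM2r ?card_incr_index_expR// mulr_ge0 ?expR_ge0.
rewrite mulrCA -expRD.
have e2 : (2 <= expR L)%R.
  by apply: le_trans (expR_ge1Dx L); move: L_ge1; lra.
apply: (@le_trans _ _ (expR L * expR (- 2 * L))%R).
  by apply: ler_pM => //; rewrite ler_expR; lra.
by rewrite -expRD ler_expR; lra.
Qed.

(** The six excluded events are: a large norm, a large low part, a large high
    part, a summand exceeding tau times its shifted norm, and a large sum on
    either side. *)
Lemma marked_sum_deviation :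
  let T := ((2 * L) `^ beta^-1)%R in
  let tau := ((3 * (r%:R * L)) `^ beta^-1)%R in
  let q := (50 * K + 16 * T ^+ 2 * L / (n %/ r)%:R)%R in
  exists bad : set Omega, [/\ measurable bad, P bad <= (6 * expR (- L))%:E &
    forall w, ~ bad w ->
      (`|\sum_(iota : incr_index n r) y (X_at X (val iota) w, Wi iota w)| <=
       (2 * K + 2) * u * Num.sqrt (L * (N * q)) + 6 * u * L * tau ^+ 2)%R].
Proof.
move=> T tau q; pose b := cond_norm W beta y; pose m := (n %/ r)%N.
have L1 := L_ge1; have L0 : (0 < L)%R by exact: lt_le_trans L_ge1.
have r1 : (1 <= r%:R :> R)%R by rewrite ler1n.
have rL : (L <= r%:R * L)%R by rewrite ler_peMl// ltW.
have N0 : (0 < N)%R by rewrite ltr0n card_incr_index_gt0.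
have K0 : (0 < K)%R by exact: lt_le_trans K_ge1.
have mb : measurable_fun [set: r.-tuple S] b by exact: measurable_cond_norm.
have b0 x : 0 <= b x by exact: cond_norm_ge0.
have m0 : (0 < m)%N by rewrite divn_gt0.
have m0' : (0 < m%:R :> R)%R by rewrite ltr0n.
have mrn : (m * r <= n)%N by exact: leq_divM.
have T0 : (0 < T)%R by rewrite powR_gt0 ?mulr_gt0.
have Tb : (T `^ beta = 2 * L)%R.
  by rewrite -powRrM mulVf ?gt_eqF// powRr1// mulr_ge0// ltW.
have taub : (tau `^ beta = 3 * (r%:R * L))%R.
  by rewrite -powRrM mulVf ?gt_eqF// powRr1// mulr_ge0// (le_trans (ltW L0)).
have tau1 : (1 <= tau)%R.
  have -> : (1 = 1 `^ beta^-1)%R by rewrite powR1.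
  apply: ge0_ler_powR; rewrite ?nnegrE ?invr_ge0 ?(ltW beta_gt0)//.
    by apply: le_trans (ge1_triple L1 rL).
  exact: ge1_triple L1 rL.
have tau0 : (0 <= tau)%R by exact: le_trans ler01 tau1.
(* The level below which all norms lie outside the first event. *)
pose M := (2 * u * tau)%R.
have M0 : (0 <= M)%R by rewrite !mulr_ge0// ltW.
(* Bound on the sum of the squared shifted norms: each is at most 8 u^2
   scaled^2 + 2 u^2, and the averages of the two parts are controlled. *)
pose Q := (N * (u ^+ 2 * q))%R.
have q0 : (0 < q)%R.
  rewrite /q ltr_pwDl// ?mulr_gt0// !mulr_ge0 ?sqr_ge0 ?invr_ge0// ltW//.
have Q0 : (0 < Q)%R by rewrite !mulr_gt0// exprn_gt0.
(* 1 / (2 D) is, up to constants, the smaller of the largest exponent allowed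
   by the truncation and the optimal Chernoff exponent for variance Q. *)
pose D := (tau * (M + u) + Num.sqrt (Q / L))%R.
have sQ0 : (0 < Num.sqrt (Q / L))%R by rewrite sqrtr_gt0 divr_gt0.
have tMu0 : (0 <= tau * (M + u))%R by rewrite mulr_ge0// addr_ge0// ltW.
have D0 : (0 < D)%R by rewrite ltr_wpDl.
pose lam := ((2 * D)^-1)%R.
have lam0 : (0 < lam)%R by rewrite invr_gt0 mulr_gt0.
have lamtau : (lam * (tau * (M + u)) <= 2^-1)%R.
  rewrite /lam invfM -mulrA ler_piMr ?invr_ge0// ler_pdivrMl// mulr1.
  by rewrite lerDl ltW.
have [mE1 PE1] := max_norm_tail Xiid kappa_uniq beta_gt0 mb b0 u_gt0 psi_b tau0.
have PE2 := low_part_tail Xiid rn kappa_uniq beta_gt0 K_ge1 HK mb b0 u_gt0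
  psi_b bsym L m0 mrn T0.
have LT : (2 * L <= T `^ beta)%R by rewrite Tb.
have PE3 := high_part_tail Xiid rn kappa_uniq beta_gt0 K_ge1 HK mb b0 u_gt0
  psi_b (ltW T0) LT.
pose E4 := [set w | exists iota : incr_index n r,
  (b (X_at X (val iota) w) <= M%:E)%E /\
     (shifted_norm W beta y u (X_at X (val iota) w) * tau <
       `|y (X_at X (val iota) w, Wi iota w)|)%R].
have [mE4 PE4] : measurable E4 /\ P E4 <= (N * (2 * expR (- (tau `^ beta))))%:E.
  have mt (iota : incr_index n r) :=
    mark_tail XW Wiid beta_gt0 my M u_gt0 iota tau0.
  exact: (union_bound (fun iota => (mt iota).1) (fun iota => (mt iota).2)).
have tail (sg : R) (sg1 : (`|sg| = 1)%R) :=
  sum_tail XW Wiid beta_gt0 K_ge1 HK my y_centered u_gt0 Q L (ltW lam0)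
    tau0 sg1 lamtau.
have [B5 [mB5 PB5 HB5]] := tail 1%R (normr1 R).
have [B6 [mB6 PB6 HB6]] := tail (-1)%R (normrN1 R).
have unionP (A B : set Omega) (p1 p2 : R) : measurable A /\ P A <= p1%:E ->
    measurable B /\ P B <= p2%:E ->
    measurable (A `|` B) /\ P (A `|` B) <= (p1 + p2)%:E.
  move=> [mA PA] [mB PB]; split; first exact: measurableU.
  by rewrite EFinD; apply: le_trans (measureU2 P mA mB) _; apply: leeD.
have mU (h : r.-tuple S -> R) (t : R) : measurable_fun [set: r.-tuple S] h ->
    measurable [set w | (t < ustat X h w)%R].
  move=> mh; rewrite -[X in measurable X]setTI.
  exact: (measurable_fun_ltr (measurable_cst _) (measurable_ustat X mh)).
have tail_le := union_tail_le taub.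
have [mbad Pbad] := unionP _ _ _ _ (unionP _ _ _ _ (unionP _ _ _ _
  (conj mE1 (le_trans PE1 (lee_tofin tail_le)))
  (conj mE4 (le_trans PE4 (lee_tofin tail_le))))
  (unionP _ _ _ _ (conj (mU _ _ (measurable_low_part u mb T)) PE2)
              (conj (mU _ _ (measurable_high_part u mb T)) PE3)))
  (unionP _ _ _ _ (conj mB5 PB5) (conj mB6 PB6)).
set bad := _ `|` _ in mbad Pbad; exists bad; split => //.
  by apply: le_trans Pbad _; rewrite lee_fin six_terms.
move=> w; rewrite /bad => /not_orP[/not_orP[/not_orP[nE1 nE4]]].
move=> /not_orP[/negP + /negP]; rewrite -!leNgt => low high /not_orP[nB5 nB6].
have bM (iota : incr_index n r) : b (X_at X (val iota) w) <= M%:E.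
  by rewrite leNgt; apply/negP => bM; apply: nE1; exists iota.
have yc (iota : incr_index n r) : (`|y (X_at X (val iota) w, Wi iota w)| <=
    shifted_norm W beta y u (X_at X (val iota) w) * tau)%R.
  by rewrite leNgt; apply/negP => yc; apply: nE4; exists iota.
have cQ : (\sum_(iota : incr_index n r)
    shifted_norm W beta y u (X_at X (val iota) w) ^+ 2 <= Q)%R.
  apply: (@le_trans _ _ (\sum_(iota : incr_index n r) (8 * u ^+ 2 *
    (low_part b u T (X_at X (val iota) w) +
     high_part b u T (X_at X (val iota) w)) + 2 * u ^+ 2))%R).
    apply: ler_sum => iota _; rewrite low_high_part /shifted_norm.
    set z := X_at X _ w.
    have -> : (fine (cond_norm W beta y z) = 2 * u * scaled b u z)%R.
      by rewrite mulrC divfK// gt_eqF// mulr_gt0.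
    rewrite -subr_ge0 [leRHS](_ : _ = (2 * u * scaled b u z - u) ^+ 2)%R.
      exact: sqr_ge0.
    by ring.
  rewrite big_split/= -mulr_sumr big_split/= sumr_const.
  rewrite -[X in (_ + X)%R]mulr_natl.
  have US h : (\sum_(iota : incr_index n r) h (X_at X (val iota) w) =
      N * ustat X h w)%R.
    by rewrite /ustat mulVKf// gt_eqF.
  rewrite !US -/N.
  have -> : (8 * u ^+ 2 * (N * ustat X (low_part b u T) w +
     N * ustat X (high_part b u T) w) + N * (2 * u ^+ 2) =
     N * (u ^+ 2 * (8 * (ustat X (low_part b u T) w +
                         ustat X (high_part b u T) w) + 2)))%R.
    by ring.
  rewrite /Q ler_wpM2l ?(ltW N0)// ler_wpM2l ?sqr_ge0// /q -/m.
  apply: (@le_trans _ _ (8 * ((4 * K + 2 * T ^+ 2 * L / m%:R) + 2 * K) + 2)%R).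
    by rewrite lerD2r ler_wpM2l// lerD.
  rewrite (_ : 16 * T ^+ 2 * L / m%:R = 8 * (2 * T ^+ 2 * L / m%:R))%R.
    exact: ustat_budget K_ge1.
  by ring.
have H5 := HB5 w nB5 bM cQ yc.
have H6 := HB6 w nB6 bM cQ yc.
set Sy := (\sum_(iota : incr_index n r) _)%R in H5 H6 *.
have Sle : (`|Sy| <= 4 * K * lam * Q + L / lam)%R.
  have -> : (4 * K * lam * Q + L / lam = lam^-1 * (4 * K * lam ^+ 2 * Q + L))%R.
    by field; rewrite gt_eqF.
  rewrite ler_norml lerNl !ler_pdivlMl//; apply/andP; split.
    by move: H6; rewrite mulN1r.
  by move: H5; rewrite mul1r.
apply: le_trans Sle _.
have -> : (4 * K * lam * Q + L / lam = 2 * K * (Q / D) + 2 * (L * D))%R.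
  by rewrite /lam; field; rewrite gt_eqF.
have sLQ : (u * Num.sqrt (L * (N * q)) = L * Num.sqrt (Q / L))%R.
  have absorb (a z : R) : (0 <= a -> a * Num.sqrt z = Num.sqrt (a ^+ 2 * z))%R.
    by move=> a0; rewrite sqrtrM ?sqr_ge0// sqrtr_sqr ger0_norm.
  rewrite !absorb ?ltW//; congr Num.sqrt.
  by rewrite /Q; field; rewrite gt_eqF.
have QD : (Q / D <= L * Num.sqrt (Q / L))%R.
  rewrite ler_pdivrMr//; apply: (@le_trans _ _ (L * Num.sqrt (Q / L) ^+ 2)%R).
    rewrite sqr_sqrtr; last by rewrite divr_ge0 ?ltW.
    by rewrite mulrC divfK// gt_eqF.
  rewrite expr2 mulrA ler_wpM2l//; last by rewrite /D lerDr.
  by rewrite mulr_ge0// ltW.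
apply: (@le_trans _ _ (2 * K * (L * Num.sqrt (Q / L)) + 2 * (L * D))%R).
  by rewrite lerD2r ler_wpM2l// mulr_ge0// ltW.
rewrite -[leRHS](_ : (2 * K + 2) * (u * Num.sqrt (L * (N * q))) +
  2 * (L * (3 * u * tau ^+ 2)) = _)%R; last by ring.
rewrite sLQ /D.
have tauM : (tau * (M + u) <= 3 * u * tau ^+ 2)%R.
  rewrite expr2 -[leRHS](_ : tau * (3 * u * tau) = _)%R; last by ring.
  rewrite ler_wpM2l// /M -!mulrA.
  have : (u * 1 <= u * tau)%R by rewrite ler_wpM2l// ltW.
  exact: shift_budget.
have : (L * (tau * (M + u)) <= L * (3 * u * tau ^+ 2))%R.
  by rewrite ler_wpM2l// ltW.
exact: deviation_budget.
Qed.

End Deviation.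

(** * Comparison of the explicit bounds *)

Section FinalBound.
Context {R : realType}.

Lemma powR_neghalf (x : R) : 0 <= x -> x `^ (- 2^-1) = (Num.sqrt x)^-1.
Proof. by move=> x0; rewrite powRN powR12_sqrt. Qed.

Lemma ln_ge1 (x : R) : 4 <= x -> 1 <= ln x.
Proof.
move=> x4; have x0 : 0 < x by lra.
rewrite -ler_expR lnK ?posrE//; apply: le_trans x4.
(* exp(1/2) <= 2 gives exp(1) <= 4. *)
have -> : 1 = 2^-1 + 2^-1 :> R by lra.
rewrite expRD; have := @expR_le_inv1B R 2^-1; have := expR_ge0 (2^-1 : R).
have -> : (1 - 2^-1)^-1 = 2 :> R by field.
by move=> e0 /(_ _); rewrite invf_lt1//; nra.
Qed.

(** The square root of a sum is bounded by squaring: 36 t^2 on the right covers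
    16 * 2 t^2 on the left, and K^2 >= K. *)
Lemma sqrt_budget (K t a L r n m : R) :
  1 <= K -> 0 <= t -> 0 <= a -> 0 <= L -> 0 <= r -> 0 < n ->
  m^-1 <= 2 * (r / n) ->
  Num.sqrt (50 * K + 16 * (t * a) ^+ 2 * L / m) <=
  (50 * K + 6 * t) *
    (1 + (Num.sqrt n)^-1 * Num.sqrt r * (a * Num.sqrt L)).
Proof.
move=> K1 t0 a0 L0 r0 n0 mrn.
set p := (Num.sqrt n)^-1 * _ * _.
have p0 : 0 <= p by rewrite !mulr_ge0 ?invr_ge0 ?sqrtr_ge0.
have p2 : p ^+ 2 = a ^+ 2 * L * (r / n).
  rewrite /p !exprMn exprVn !sqr_sqrtr ?(ltW n0)//.
  by field; rewrite gt_eqF.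
have K0 : 0 <= K by lra.
have C0 : 0 <= 50 * K + 6 * t by rewrite addr_ge0// mulr_ge0.
rewrite -[leRHS]ger0_norm; last by rewrite mulr_ge0// addr_ge0.
rewrite -sqrtr_sqr; apply: ler_wsqrtr.
apply: (@le_trans _ _ ((50 * K) ^+ 2 + (6 * t * p) ^+ 2)).
  apply: lerD; first by rewrite expr2; nra.
  rewrite [leRHS]exprMn p2.
  apply: (@le_trans _ _ (16 * (t * a) ^+ 2 * L * (2 * (r / n)))).
    by rewrite ler_wpM2l// !mulr_ge0// sqr_ge0.
  have : 0 <= t ^+ 2 * (a ^+ 2 * L * (r / n)).
    by rewrite !mulr_ge0 ?sqr_ge0// invr_ge0 ltW.
  rewrite !exprMn; lra.
have H : 0 <= 50 * K * p by rewrite !mulr_ge0.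
have tp : 0 <= t * p by rewrite mulr_ge0.
apply: (@le_trans _ _ ((50 * K + 6 * (t * p)) ^+ 2)).
  rewrite -[6 * t * p]mulrA sqrrD -addrA lerD2l lerDr mulrn_wge0// !mulr_ge0//.
rewrite ler_sqr ?nnegrE; last 2 first.
  by rewrite addr_ge0// mulr_ge0.
  by rewrite mulr_ge0// addr_ge0.
rewrite mulrDl !mulrDr !mulr1; lra.
Qed.

(** Both bounds are products of L^(1/beta), r^(1/beta) and square roots of L,
    N, r and n; the extra powers of r and of log n in the target are at least
    1. *)
Lemma deviation_le_Zbound (beta K u : R) (n d r : nat) :
  0 < beta -> beta <= 1 -> 1 <= K -> 0 <= u ->
  (4 <= n)%N -> (3 <= d)%N -> (2 <= r)%N -> (r <= n)%N ->
  let N : R := #|{: incr_index n r}|%:R in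
  let L : R := ln (d * n)%:R in
  let t2 : R := 2 `^ beta^-1 in
  let t3 : R := 3 `^ beta^-1 in
  let q := 50 * K + 16 * ((2 * L) `^ beta^-1) ^+ 2 * L / (n %/ r)%:R in
  is_true (N^-1 * ((2 * K + 2) * u * Num.sqrt (L * (N * q)) +
                   6 * u * L * ((3 * (r%:R * L)) `^ beta^-1) ^+ 2) <=
    Zbound beta ((2 * K + 2) * (50 * K + 6 * t2) + 6 * t3 ^+ 2) u n d r).
Proof.
move=> b0 b1 K1 u0 n4 d3 r2 rn N L t2 t3 q.
set C := (_ + 6 * t3 ^+ 2).
have r_gt0 : (0 < r)%N by exact: leq_trans r2.
have n_gt0 : (0 < n)%N by exact: leq_trans n4.
have n0 : 0 < n%:R :> R by rewrite ltr0n.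
have r0 : 0 < r%:R :> R by rewrite ltr0n.
have r1 : 1 <= r%:R :> R by rewrite ler1n.
have N0 : 0 < N by rewrite ltr0n card_incr_index_gt0.
have l1 : 1 <= ln n%:R :> R by apply: ln_ge1; rewrite (ler_nat _ 4).
have L1 : 1 <= L.
  apply: ln_ge1; rewrite (ler_nat _ 4); apply: leq_trans n4 _.
  by rewrite leq_pmull// (leq_trans _ d3).
have L0 : 0 <= L by exact: le_trans ler01 L1.
have Lp : 0 < L by exact: lt_le_trans L1.
have bV1 : 1 <= beta^-1 by rewrite invf_ge1.
pose a := L `^ beta^-1; pose rho : R := r%:R `^ beta^-1.
have a0 : 0 <= a by exact: powR_ge0.
have rho0 : 0 <= rho by exact: powR_ge0.
have t20 : 0 <= t2 by exact: powR_ge0.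
have t30 : 0 <= t3 by exact: powR_ge0.
have C10 : 0 <= (2 * K + 2) * (50 * K + 6 * t2).
  by rewrite mulr_ge0// addr_ge0// ?mulr_ge0//; lra.
have C20 : 0 <= 6 * t3 ^+ 2 by rewrite mulr_ge0// sqr_ge0.
have C0 : 0 <= C by rewrite addr_ge0.
have powR2 (x : R) : x `^ (2 / beta) = (x `^ beta^-1) ^+ 2.
  by rewrite mulrC powRrM powR_mulrn ?powR_ge0.
have E2 : (2 * L) `^ beta^-1 = t2 * a by rewrite powRM.
have E3 : (3 * (r%:R * L)) `^ beta^-1 = t3 * (rho * a).
  by rewrite !powRM// mulr_ge0.
have EL1 : L `^ (beta^-1 + 2^-1) = a * Num.sqrt L.
  by rewrite powRD ?powR12_sqrt// (gt_eqF Lp) implybT.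
have EL2 : L `^ (2 / beta + 1) = a ^+ 2 * L.
  by rewrite powRD ?powR2 ?powRr1// (gt_eqF Lp) implybT.
have El1 : 1 <= (ln n%:R : R) `^ (beta^-1 - 2^-1).
  by rewrite -[leLHS](powRr0 (ln n%:R : R)) ler_powR//; lra.
have El2 : 1 <= (ln n%:R : R) `^ (2 / beta - 1).
  by rewrite -[leLHS](powRr0 (ln n%:R : R)) ler_powR//; lra.
have Erho : rho ^+ 2 <= r%:R `^ (3 / beta).
  by rewrite -powR2 ler_powR// ler_wpM2r ?invr_ge0 ?(ltW b0)// ler_nat.
have mrn : ((n %/ r)%:R : R)^-1 <= 2 * (r%:R / n%:R).
  have m0 : 0 < (n %/ r)%:R :> R by rewrite ltr0n divn_gt0.
  rewrite -div1r ler_pdivrMr// (_ : 2 * _ * _ =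
    (2 * (r * (n %/ r)))%:R / n%:R); last by rewrite !natrM; ring.
  rewrite ler_pdivlMr// mul1r ler_nat {1}(divn_eq n r) mul2n -addnn mulnC.
  rewrite leq_add2l (leq_trans (ltnW (ltn_pmod n r_gt0)))// leq_pmulr//.
  by rewrite divn_gt0.
have S1 : Num.sqrt q <= (50 * K + 6 * t2) *
    (1 + (Num.sqrt n%:R)^-1 * Num.sqrt r%:R * (a * Num.sqrt L)).
  by rewrite /q E2; apply: sqrt_budget => //; exact: ltW.
have q0 : 0 <= q.
  have K0 : 0 <= K by exact: le_trans ler01 K1.
  by rewrite /q addr_ge0 ?mulr_ge0 ?powR_ge0 ?invr_ge0.
have sN : N^-1 * Num.sqrt (L * (N * q)) =
    (Num.sqrt N)^-1 * Num.sqrt L * Num.sqrt q.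
  rewrite !sqrtrM ?(ltW N0)//.
  rewrite -[N in N^-1](sqr_sqrtr (ltW N0)); field.
  by rewrite gt_eqF// sqrtr_gt0.
rewrite mulrDr /Zbound -/N -/L !powR_neghalf ?(ltW N0) ?(ltW n0)//.
rewrite !powR12_sqrt ?(ltW r0)// EL1 EL2 E3.
have sr1 : 1 <= Num.sqrt (r%:R : R) by rewrite -[leLHS](@sqrtr1 R) ler_wsqrtr.
set si := (Num.sqrt N)^-1; have si0 : 0 <= si by rewrite invr_ge0 sqrtr_ge0.
have sL0 : 0 <= Num.sqrt L by exact: sqrtr_ge0.
apply: lerD.
  rewrite [leLHS](_ : _ =
    (2 * K + 2) * u * (N^-1 * Num.sqrt (L * (N * q)))); last by ring.
  rewrite sN -/si.
  set p := (Num.sqrt n%:R)^-1 * _ * _ in S1.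
  have p0 : 0 <= p by rewrite !mulr_ge0 ?invr_ge0 ?sqrtr_ge0.
  apply: (@le_trans _ _ (C * u * si * 1 * Num.sqrt L * (1 + p * 1))).
    apply: (@le_trans _ _ ((2 * K + 2) * u * (si * Num.sqrt L *
        ((50 * K + 6 * t2) * (1 + p))))).
      rewrite ler_wpM2l ?mulr_ge0//; first by lra.
      by rewrite ler_wpM2l ?mulr_ge0.
    rewrite !mulr1 [leLHS](_ : _ = (2 * K + 2) * (50 * K + 6 * t2) *
      (u * si * Num.sqrt L * (1 + p))); last by ring.
    rewrite [leRHS](_ : _ = C * (u * si * Num.sqrt L * (1 + p))); last by ring.
    by rewrite ler_wpM2r ?lerDl// !mulr_ge0// addr_ge0.
  apply: ler_pM.
  - by rewrite !mulr_ge0.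
  - by rewrite mulr1 addr_ge0.
  - by rewrite ler_wpM2r// ler_wpM2l// !mulr_ge0.
  - by rewrite lerD2l ler_wpM2l.
rewrite [leLHS](_ : _ = 6 * t3 ^+ 2 * u * N^-1 * rho ^+ 2 * (a ^+ 2 * L) * 1);
  last by ring.
have NV0 : 0 <= N^-1 by rewrite invr_ge0 ltW.
have aL0 : 0 <= a ^+ 2 * L by rewrite mulr_ge0 ?sqr_ge0.
do 5?[apply: ler_pM => //]; rewrite ?mulr_ge0 ?sqr_ge0//.
by rewrite /C lerDr.
Qed.

End FinalBound.

(** * The maximum over the coordinates *)

Section CenteredKernel.
Context {dO : measure_display} {Omega : measurableType dO} {R : realType}.
Variable P : probability Omega R.
Context {dS : measure_display} {S : measurableType dS}.
Context {dS' : measure_display} {S' : measurableType dS'}.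
Variables (d r : nat) (F : r.-tuple S * S' -> d.-tuple R).
Variable W : {RV P >-> S'}.
Hypothesis mF : measurable_fun [set: r.-tuple S * S'] F.
Hypothesis Fsym : symmetric_kernel F.

(** The summand of [Zmax] as a function of the subsample and its mark. *)
Definition centered_kernel (j : 'I_d) (z : r.-tuple S * S') : R :=
  tnth (F z) j - kernel_f F W j z.1.

Lemma measurable_tnth_kernel j :
  measurable_fun [set: r.-tuple S * S'] (fun z => tnth (F z) j).
Proof. exact: (measurableT_comp (measurable_tnth j) mF). Qed.

Lemma measurable_centered_kernel j :
  measurable_fun [set: r.-tuple S * S'] (centered_kernel j).
Proof.
apply: measurable_funB; first exact: measurable_tnth_kernel.
have mf := measurable_mean_mark W (measurable_tnth_kernel j).
exact: (measurableT_comp mf).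
Qed.

Lemma cond_norm_kernel_sym beta j :
  symmetric_fun (cond_norm W beta (centered_kernel j)).
Proof.
move=> s x; rewrite /cond_norm; congr psi_norm; apply/funext => w.
rewrite /centered_kernel /kernel_f /= Fsym; congr (_ - fine _)%:E.
by congr expectation; apply/funext => v; rewrite Fsym.
Qed.

End CenteredKernel.

Theorem lemmaA7 (R : realType) (beta : R) (beta_gt0 : 0 < beta)
    (beta_le1 : beta <= 1) :
  exists C : R, 0 < C /\
  forall (n d r : nat) (n_ge4 : (4 <= n)%N) (d_ge3 : (3 <= d)%N)
    (r_ge2 : (2 <= r)%N) (r_le_n : (r <= n)%N)
    (dO dS dS' : measure_display) (Omega : measurableType dO)
    (S : measurableType dS) (S' : measurableType dS')
    (P : probability Omega R)
    (X : 'I_n -> {RV P >-> S}) (W : {RV P >-> S'})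
    (Wi : incr_index n r -> {RV P >-> S'})
    (F : r.-tuple S * S' -> d.-tuple R) (u : R),
  iid X ->
  iid (oapp Wi W) ->
  independent_families X (oapp Wi W) ->
  measurable_fun setT F ->
  symmetric_kernel F ->
  1 <= u ->
  (forall j : 'I_d,
    (psi_norm P beta (fun w =>
       kernel_b F beta W j (X_at X [tuple widen_ord r_le_n k | k < r] w))
     <= u%:E)%E) ->
  ((1 - 9 / n%:R)%:E <=
     P [set w | (Zmax F X W Wi w <= Zbound beta C u n d r)%R])%E.
Proof.
have [K K1 HK] := sqr_le_expR_powR beta_gt0.
pose C1 : R := (2 * K + 2) * (50 * K + 6 * 2 `^ beta^-1).
have C1_ge0 : 0 <= C1.
  by rewrite mulr_ge0 ?addr_ge0 ?mulr_ge0 ?powR_ge0 ?(le_trans ler01 K1).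
exists (C1 + 6 * (3 `^ beta^-1) ^+ 2); split.
  by rewrite ltr_wpDl// mulr_gt0// exprn_gt0// powR_gt0.
move=> n d r n4 d3 r2 rn dO dS dS' Omega S S' P X W Wi F u Xiid Wiid XW mF Fsym
  u1 psi_b.
set C := (C1 + _).
have r0 : (0 < r)%N by exact: leq_trans r2.
have n0 : (0 < n)%N by exact: leq_trans n4.
have d0 : (0 < d)%N by exact: leq_trans d3.
have u0 : 0 < u by exact: lt_le_trans u1.
pose L : R := ln (d * n)%:R.
have nL : ln n%:R <= L.
  by rewrite ler_ln ?posrE ?ltr0n ?muln_gt0 ?d0// ler_nat leq_pmull.
have L1 : 1 <= L.
  by apply: le_trans nL; apply: ln_ge1; rewrite (ler_nat _ 4).
pose kappa : r.-tuple 'I_n := [tuple widen_ord rn k | k < r].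
have kappa_uniq : uniq kappa.
  apply/tuple_uniqP => i j; rewrite !tnth_mktuple => /(congr1 val)/= ij.
  exact/val_inj.
have bads (j : 'I_d) := marked_sum_deviation Xiid XW Wiid r0 rn beta_gt0 K1 HK
  (measurable_centered_kernel W mF j)
  (fun x => cond_norm_centered (x := x) beta_gt0 (measurable_tnth_kernel mF j))
  (cond_norm_kernel_sym W Fsym beta j) kappa_uniq u0 (psi_b j) L1 nL.
have [bad bad_spec] := boolp.choice bads.
have mbad j : measurable (bad j) by have [] := bad_spec j.
have Pbad j : (P (bad j) <= (6 * expR (- L))%:E)%E by have [] := bad_spec j.
have [mU PU] := union_bound mbad Pbad.
set U := [set w | exists j, _] in mU PU.
pose N : R := #|{: incr_index n r}|%:R.
pose avg (j : 'I_d) (w : Omega) : R := N^-1 * \sum_(iota : incr_index n r)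
  (tnth (F (X_at X (val iota) w, Wi iota w)) j
   - kernel_f F W j (X_at X (val iota) w)).
have Nge0 : 0 <= N^-1 by rewrite invr_ge0.
have bound := deviation_le_Zbound beta_gt0 beta_le1 K1 (ltW u0) n4 d3 r2 rn.
have avg_le w j : ~ U w -> `|avg j w| <= Zbound beta C u n d r.
  move=> nUw; apply: le_trans bound.
  rewrite normrM ger0_norm// ler_wpM2l//.
  have [_ _] := bad_spec j; apply.
  by move=> badj; apply: nUw; exists j.
have Zb0 : 0 <= Zbound beta C u n d r.
  apply: le_trans bound; rewrite mulr_ge0// addr_ge0//.
    have K0 := le_trans ler01 K1.
    by rewrite !mulr_ge0 ?sqrtr_ge0 ?addr_ge0 ?mulr_ge0 ?(ltW u0).
  by rewrite !mulr_ge0 ?(ltW u0) ?powR_ge0 ?(le_trans ler01 L1).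
have ZmaxE w : (Zmax F X W Wi w <= Zbound beta C u n d r) <->
    (forall j, `|avg j w| <= Zbound beta C u n d r).
  split=> [/bigmax_leP[_ H] j|H]; first exact: H.
  by apply/bigmax_leP; split => // j _; exact: H.
have mavg j : measurable_fun [set: Omega] (avg j).
  apply: measurable_funM => //; apply: measurable_sum => iota.
  apply: (measurableT_comp (measurable_centered_kernel W mF j)).
  by apply/measurable_fun_pair; [exact: measurable_X_at|exact: measurable_funP].
have mG : measurable [set w | Zmax F X W Wi w <= Zbound beta C u n d r].
  rewrite (_ : [set w | _] = \bigcap_(j in [set: 'I_d])
      [set w | `|avg j w| <= Zbound beta C u n d r]); last first.
    by apply/seteqP; split => w /= => [/ZmaxE H j _|H]; [exact: H|
      apply/ZmaxE => j; exact: H].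
  apply: fin_bigcap_measurable => [|j _]; first exact: finite_finset.
  have mn : measurable_fun [set: Omega] (fun w => `|avg j w|).
    by apply: measurableT_comp.
  rewrite -[X in measurable X]setTI.
  exact: (measurable_fun_ler mn (measurable_cst _)).
apply: (@le_trans _ _ (P (~` U))); last first.
  apply: le_measure; rewrite ?inE//; first exact: measurableC.
  by move=> w nUw; apply/ZmaxE => j; exact: avg_le.
rewrite probability_setC// EFinB leeB//; apply: le_trans PU _.
rewrite lee_fin card_ord.
have -> : expR (- L) = (d%:R * n%:R)^-1.
  by rewrite expRN lnK ?natrM// posrE mulr_gt0 ?ltr0n.
rewrite [leLHS](_ : _ = 6 / n%:R).
  by rewrite ler_wpM2r ?invr_ge0// ler_nat.
by field; rewrite !pnatr_eq0 -!lt0n d0 n0.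
Qed.
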